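(* Let $\mathcal{E}$ be an $n$-dimensional complex evolution algebra which is complete and not nilpotent. Then $\mathcal{E}$ is isomorphic to one of the following pairwise non-isomorphic algebras: \[ \{e_1^2=e_1\}\oplus \mathbb{C}^{n-1}\qquad\text{or}\qquad \{e_1^2=e_1\}\oplus \widetilde{\mathcal{E}}\oplus \mathbb{C}^{n-s-1}, \] where $\widetilde{\mathcal{E}}$ is an $s$-dimensional evolution algebra with maximal index of nilpotency.
   Context: An evolution algebra over $\mathbb{C}$ is a $\mathbb{C}$-algebra $\mathcal{E}$ admitting a basis $\{e_1,\dots,e_n\}$ (a natural basis) such that $e_ie_j=0$ for all $i\neq j$. $\mathcal{E}$ is complete if every subalgebra of $\mathcal{E}$ admits a natural basis which can be extended to a natural basis of $\mathcal{E}$. $\{e_1^2=e_1\}$ denotes the one-dimensional evolution algebra spanned by $e_1$ with $e_1^2=e_1$; $\mathbb{C}^k$ denotes the $k$-dimensional zero evolution algebra (all products zero); $\oplus$ is the direct sum of algebras. Powers are defined by $\mathcal{E}^1=\mathcal{E}$ and $\mathcal{E}^k=\sum_{i=1}^{k-1}\mathcal{E}^i\mathcal{E}^{k-i}$; $\mathcal{E}$ is nilpotent if $\mathcal{E}^k=0$ for some $k$, and its index of nilpotency is the least such $k$. An $s$-dimensional evolution algebra has maximal index of nilpotency if it is nilpotent and its index of nilpotency is the largest possible among all $s$-dimensional nilpotent evolution algebras. *)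

(* Defs.v *)
From HB Require Import structures.
From mathcomp Require Import all_boot all_order all_algebra.

Set Implicit Arguments. Unset Strict Implicit. Unset Printing Implicit Defensive.
Import Order.TTheory GRing.Theory Num.Theory.
Local Open Scope ring_scope.

Section Algebras.
Variable F : fieldType.

(* An n-dimensional (not necessarily associative) F-algebra: the product
   mu i j of the i-th and j-th standard basis vectors of F^n. *)
Definition alg (n : nat) := 'I_n -> 'I_n -> 'rV[F]_n.

Definition amul n (mu : alg n) (x y : 'rV[F]_n) : 'rV[F]_n :=
  \sum_(i < n) \sum_(j < n) (x 0 i * y 0 j) *: mu i j.

Definition natural_basis n (mu : alg n) (B : 'M[F]_n) : Prop :=
  B \in unitmx /\ forall i j : 'I_n, i != j -> amul mu (row i B) (row j B) = 0.

Definition evolution n (mu : alg n) : Prop := exists B, natural_basis mu B.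

Definition subalgebra n (mu : alg n) (S : 'M[F]_n) : Prop :=
  forall x y : 'rV[F]_n, (x <= S)%MS -> (y <= S)%MS -> (amul mu x y <= S)%MS.

(* complete: every subalgebra has a natural basis extendable to a natural
   basis of the whole algebra, i.e. it is spanned by a subfamily of some
   natural basis of the algebra *)
Definition complete n (mu : alg n) : Prop :=
  forall S : 'M[F]_n, subalgebra mu S ->
    exists B : 'M[F]_n, natural_basis mu B /\
      exists I : {set 'I_n}, (S == \sum_(i in I) <<row i B>>)%MS.

Definition prodsp n (mu : alg n) (A B : 'M[F]_n) : 'M[F]_n :=
  (\sum_(a < n) \sum_(b < n) <<amul mu (row a A) (row b B)>>)%MS.

(* epows k = [:: E^1; ...; E^k], with E^1 = E and
   E^k = sum_{i=1}^{k-1} E^i E^(k-i) *)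
Fixpoint epows n (mu : alg n) (k : nat) : seq 'M[F]_n :=
  match k with
  | 0 => [::]
  | k'.+1 =>
      let s := epows mu k' in
      rcons s (if k' is 0 then 1%:M
               else (\sum_(i < k') prodsp mu (nth 0 s i) (nth 0 s (k' - 1 - i)%N))%MS)
  end.

Definition epow n (mu : alg n) (k : nat) : 'M[F]_n := last 1%:M (epows mu k).

Definition nilpotent n (mu : alg n) : Prop :=
  exists k, (0 < k)%N /\ epow mu k = 0.

Definition nil_index n (mu : alg n) (k : nat) : Prop :=
  [/\ (0 < k)%N, epow mu k = 0 &
      forall j, (0 < j)%N -> (j < k)%N -> epow mu j != 0].

Definition max_nil_index s (mu : alg s) : Prop :=
  evolution mu /\ exists k, nil_index mu k /\
    forall (mu' : alg s) k', evolution mu' -> nil_index mu' k' -> (k' <= k)%N.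

(* isomorphism of algebras (of possibly syntactically different dimensions):
   a bijective linear map preserving products *)
Definition alg_iso m k (mu1 : alg m) (mu2 : alg k) : Prop :=
  exists f : 'M[F]_(m, k), [/\ row_free f, row_full f &
    forall x y, amul mu1 x y *m f = amul mu2 (x *m f) (y *m f)].

Definition dsum m k (mu1 : alg m) (mu2 : alg k) : alg (m + k) :=
  fun i j => match split i, split j with
             | inl a, inl b => row_mx (mu1 a b) 0
             | inr a, inr b => row_mx 0 (mu2 a b)
             | _, _ => 0
             end.

Definition idem1 : alg 1 := fun _ _ => const_mx 1.

Definition zero_alg (k : nat) : alg k := fun _ _ => 0.
Arguments zero_alg k : clear implicits.

Definition algA n : alg (1 + (n - 1))%N := dsum idem1 (zero_alg (n - 1)%N).

Definition algB n s (Et : alg s) : alg (1 + (s + (n - s - 1)))%N :=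
  dsum idem1 (dsum Et (zero_alg (n - s - 1)%N)).

End Algebras.
Arguments zero_alg : clear implicits.
Arguments algA : clear implicits.
Arguments algB {F} n {s} Et.

(* Main.v *)
Require Import Defs.
From HB Require Import structures.
From mathcomp Require Import all_boot all_order all_algebra.
From mathcomp Require Import reals complex.
Import Order.TTheory GRing.Theory Num.Theory.
Local Open Scope ring_scope.
Set Implicit Arguments. Unset Strict Implicit. Unset Printing Implicit Defensive.

(* Completeness is used through two consequences: every subalgebra S has a
   natural basis, and E = S + {t | S t = 0} (ann_compl).  The latter turns the
   derived series D_k into a central series, D_k E <= D_(k+1), so if E is not
   nilpotent the series stabilises at some D = D^2 != 0.

   D is an evolution algebra with invertible structure matrix.  Its idempotents
   solve a system x_i^2 = \sum_j b_ij x_j with b invertible, and a nonzero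
   solution is a character of the commutative algebra of dimension 2^m presented
   by these equations, that is, a common eigenvector of its multiplication
   matrices.  If dim D > 1 this gives an idempotent with at least two nonzero
   coordinates, whose span has no annihilating complement; so D = <e>, e^2 = e.

   A maximal subalgebra avoiding e equals T = {x | e x = 0}: otherwise it could be
   enlarged by some t + c e, with c^2 cancelling the e-component of t^2.  So
   E = <e> + T with T a nilpotent ideal.  For u, y in T annihilating T^2 one has
   u y in <u^2>; over C this leaves, modulo the annihilator of T, a single
   generator x, and T = N + Z with N = <x> + T^2 and Z annihilating T.  The
   derived series of N loses one dimension per step, hence
   N^(2^(s-1)) != 0, the largest value possible in dimension s = dim N.

   For the non-isomorphism part: in an algebra of maximal nilpotency index the
   square has codimension one and contains the annihilator, which makes
   Et -> algB n Et -> algB n Et' -> Et' injective. *)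

(** * Idempotents of an evolution algebra with invertible structure matrix *)

(** Commuting matrices over an algebraically closed field share an eigenvector. Applied to the
    transposed restrictions of the [M i] to [W], this gives an eigenfunctional on [W], which [u]
    extends to the whole space. *)
Lemma common_functional (C : numClosedFieldType) m N (W : 'M[C]_N)
    (M : 'I_m -> 'M_N) :
  W != 0 -> (forall i, stablemx W (M i)) ->
  (forall i j, M i *m M j = M j *m M i) ->
  exists (u : 'cV_N) (mu : 'I_m -> C),
    (exists2 v : 'rV_N, (v <= W)%MS & v *m u != 0) /\
    forall i (v : 'rV_N), (v <= W)%MS -> v *m M i *m u = mu i *: (v *m u).
Proof.
move=> W0 Wst Mcomm.
have [P [Pf PW]] : exists P : 'M_(\rank W, N), row_free P /\ (P :=: W)%MS.
  by exists (row_base W); rewrite row_base_free; split=> //; apply: eq_row_base.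
have Pst i : stablemx P (M i).
  by rewrite PW (submx_trans _ (Wst i)) // submxMr // PW.
pose Q i := conjmx P (M i).
have QM i j : Q i *m Q j = conjmx P (M i *m M j).
  by rewrite [RHS]conjmxM ?inE ?Pst.
have [||w w0 /allP wst] :=
    @common_eigenvector C _ [seq (Q i)^T | i <- enum 'I_m].
- by rewrite lt0n mxrank_eq0.
- move=> _ _ /mapP[i _ ->] /mapP[j _ ->]; rewrite /comm_mx -!trmx_mul.
  by rewrite !QM Mcomm.
have mu_ex i : exists a, w *m (Q i)^T = a *: w.
  apply/sub_rVP; apply: wst.
  by apply/mapP; exists i; rewrite ?mem_enum.
have {mu_ex} [mu muE] := fin_all_exists mu_ex.
have [G GE] : exists G, G = pinvmx P by exists (pinvmx P).
have PG : P *m G = 1%:M by rewrite GE mulmxVp.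
(* [w] is a functional in the coordinates of the basis [P]; the right inverse [G] of [P] carries it
   to ambient coordinates. *)
exists (G *m w^T), mu; split.
  have /rV0Pn[k wk] := w0.
  exists (row k P); first by rewrite -PW row_sub.
  rewrite rowE -mulmxA (mulmxA P) PG mul1mx -rowE.
  apply: contraNneq wk => /matrixP/(_ 0 0).
  by rewrite !mxE => ->.
move=> i v; rewrite -PW => /submxP[y ->].
rewrite -!mulmxA (mulmxA P G) PG mul1mx.
have -> : P *m (M i *m (G *m w^T)) = Q i *m w^T.
  by rewrite /Q /conjmx -GE !mulmxA.
have -> : Q i *m w^T = mu i *: w^T.
  apply: trmx_inj; rewrite trmx_mul trmxK linearZ /= trmxK.
  exact: muE.
by rewrite scalemxAr.
Qed.

(* The commutative algebra K[x_1..x_m]/(x_i^2 - \sum_j b_ij x_j) in the basis of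
   squarefree monomials x_S; its characters are the solutions of the system. *)
Section SquarefreeAlgebra.
Variables (K : fieldType) (m : nat) (b : 'M[K]_m).
Implicit Types S U : {set 'I_m}.

Notation N := #|{set 'I_m}|.

Definition mon (S : {set 'I_m}) : 'rV[K]_N := delta_mx 0 (enum_rank S).

(** [k] is fuel, started at #|S|: each reduction x_i x_S = \sum_j b_ij x_j x_(S - i) removes one
    element, so the value 0 for exhausted fuel is never reached. *)
Fixpoint var_mon k i (S : {set 'I_m}) : 'rV[K]_N :=
  if i \in S then
    (if k is k'.+1 then \sum_j b i j *: var_mon k' j (S :\ i) else 0)
  else mon (i |: S).

Definition var_mx i : 'M[K]_N :=
  \matrix_(a < N) let S : {set 'I_m} := enum_val a in var_mon #|S| i S.

Lemma mon_var S i : mon S *m var_mx i = var_mon #|S| i S.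
Proof. by rewrite -rowE rowK enum_rankK. Qed.

Lemma mon_var_notin S i : i \notin S -> mon S *m var_mx i = mon (i |: S).
Proof. by rewrite mon_var; case: #|S| => [|k] /negbTE /= ->. Qed.

Lemma mon_var_in S i : i \in S ->
  mon S *m var_mx i = \sum_j b i j *: (mon (S :\ i) *m var_mx j).
Proof.
move=> iS; rewrite mon_var (cardsD1 i S) iS add1n /= iS.
by apply: eq_bigr => j _; rewrite mon_var.
Qed.

Lemma mon_setD1 S i : i \in S -> mon S = mon (S :\ i) *m var_mx i.
Proof. by move=> iS; rewrite mon_var_notin ?setD11 // setD1K. Qed.

Lemma mon_var_sqr_notin S i : i \notin S ->
  mon S *m var_mx i *m var_mx i = \sum_j b i j *: (mon S *m var_mx j).
Proof.
by move=> iS; rewrite mon_var_notin // mon_var_in ?setU11 // setU1K.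
Qed.

(** Induction on #|S|. When both indices lie in S, either order rewrites both squares and ends in a
    double sum over S minus {i, j}, where the induction hypothesis swaps the two remaining
    factors. *)
Lemma mon_var_comm S i j :
  mon S *m var_mx i *m var_mx j = mon S *m var_mx j *m var_mx i.
Proof.
elim: {S}_.+1 {-2}S (ltnSn #|S|) i j => // k IH S; rewrite ltnS => Sk i j.
have [->//|ij] := eqVneq i j.
have half (a c : 'I_m) : a != c -> a \notin S -> c \in S ->
    mon S *m var_mx a *m var_mx c = mon S *m var_mx c *m var_mx a.
  move=> ac aS cS; have Sc : (#|S :\ c| < k)%N.
    by apply: leq_trans Sk; rewrite (cardsD1 c S) cS.
  rewrite mon_var_notin // mon_var_in ?setU1r // mon_var_in // mulmx_suml.
  apply: eq_bigr => l _; rewrite -scalemxAl; congr (_ *: _).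
  rewrite IH // (mon_var_notin (i := a)) ?inE ?(negbTE aS) ?andbF //.
  congr (mon _ *m _); apply/setP => z; rewrite !inE.
  by case: (eqVneq z a) => [->|]; rewrite ?ac.
case: (boolP (i \in S)) => iS; case: (boolP (j \in S)) => jS; first last.
- rewrite !mon_var_notin ?inE ?negb_or ?(eq_sym j) ?ij //.
  by congr mon; rewrite !setUA [[set j] :|: _]setUC.
- by apply: half.
- by symmetry; apply: half; rewrite // eq_sym.
have small U a : a \in S -> U \subset S :\ a -> (#|U| < k)%N.
  move=> aS /subset_leq_card US; apply: leq_ltn_trans US _.
  by apply: leq_trans Sk; rewrite (cardsD1 a S) aS.
pose U := S :\ i :\ j.
have USi : U \subset S :\ i by apply: subD1set.
have UE : S :\ j :\ i = U by rewrite /U !setDDl setUC.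
have symE (a c : 'I_m) : a \in S -> c \in S -> a != c -> S :\ c :\ a = U ->
    a \notin U -> c \notin U -> mon S *m var_mx c *m var_mx a =
    \sum_l \sum_h (b c l * b a h) *: (mon U *m var_mx h *m var_mx l).
  move=> aS cS ac UE' aU cU.
  rewrite mon_var_in // mulmx_suml; apply: eq_bigr => l _.
  rewrite -scalemxAl IH; last by apply: (small _ c).
  rewrite (@mon_setD1 (S :\ c) a) ?inE ?ac // UE' mon_var_sqr_notin //.
  rewrite mulmx_suml scaler_sumr; apply: eq_bigr => h _.
  by rewrite -scalemxAl scalerA.
rewrite (symE j i) // ?(eq_sym j) // ?inE ?eqxx ?andbF //.
rewrite (symE i j) // ?inE ?eqxx ?andbF //.
rewrite exchange_big /=; apply: eq_bigr => l _; apply: eq_bigr => h _.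
by rewrite mulrC IH //; apply: (small _ i).
Qed.

Lemma mon_var_sqr S i :
  mon S *m var_mx i *m var_mx i = \sum_j b i j *: (mon S *m var_mx j).
Proof.
case: (boolP (i \in S)) => [iS|]; last exact: mon_var_sqr_notin.
rewrite {1}mon_var_in // mulmx_suml; apply: eq_bigr => j _.
by rewrite -scalemxAl mon_var_comm -(mon_setD1 iS).
Qed.

Lemma mon_eq (A B : 'M[K]_N) : (forall S, mon S *m A = mon S *m B) -> A = B.
Proof.
move=> AB; apply/row_matrixP => a; rewrite !rowE.
by have := AB (enum_val a); rewrite /mon enum_valK.
Qed.

Lemma var_mx_comm i j : var_mx i *m var_mx j = var_mx j *m var_mx i.
Proof. by apply: mon_eq => S; rewrite !mulmxA mon_var_comm. Qed.

Lemma var_mx_sqr i : var_mx i *m var_mx i = \sum_j b i j *: var_mx j.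
Proof.
apply: mon_eq => S; rewrite mulmxA mon_var_sqr mulmx_sumr.
by apply: eq_bigr => j _; rewrite scalemxAr.
Qed.

(* The zero solution corresponds to the character x_S |-> 0 for S nonempty, which
   vanishes on this ideal, so a nonzero functional on it excludes that solution. *)
Definition aug_ideal : 'M[K]_N := (\sum_(S | S != set0) <<mon S>>)%MS.

Lemma mon_aug_ideal S : S != set0 -> (mon S <= aug_ideal)%MS.
Proof. by move=> S0; rewrite (sumsmx_sup S) // genmxE. Qed.

(** The defining relations have no constant term, so a reduction never produces the monomial of the
    empty set. *)
Lemma var_aug_ideal S i : (mon S *m var_mx i <= aug_ideal)%MS.
Proof.
elim: {S}_.+1 {-2}S (ltnSn #|S|) i => // k IH S; rewrite ltnS => Sk i.
case: (boolP (i \in S)) => iS; last first.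
  rewrite mon_var_notin // mon_aug_ideal //; apply/set0Pn.
  by exists i; rewrite setU11.
rewrite mon_var_in // summx_sub // => j _; rewrite scalemx_sub // IH //.
by apply: leq_trans Sk; rewrite (cardsD1 i S) iS.
Qed.

Lemma aug_ideal_stable i : stablemx aug_ideal (var_mx i).
Proof.
rewrite sumsmxMr; apply/sumsmx_subP => S _.
by rewrite (eqmxMr _ (genmxE _)) var_aug_ideal.
Qed.
End SquarefreeAlgebra.

(** The solution consists of the eigenvalues of a common eigenfunctional on the augmentation ideal;
    evaluating it on x_i^2 v gives the equations. *)
Lemma quadratic_system (C : numClosedFieldType) m (b : 'M[C]_m) :
  (0 < m)%N -> b \in unitmx ->
  exists2 x : 'rV[C]_m, x != 0 & forall i, x 0 i ^+ 2 = \sum_j b i j * x 0 j.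
Proof.
case: m b => // m b _ bU.
have monS (S : {set 'I_m.+1}) : S != set0 -> (mon C S <= aug_ideal C m.+1)%MS.
  exact: mon_aug_ideal.
have mon0 (S : {set 'I_m.+1}) : mon C S != 0.
  by apply/eqP => /rowP/(_ (enum_rank S)) /eqP; rewrite !mxE !eqxx oner_eq0.
have s10 (i : 'I_m.+1) : [set i] != set0 by apply/set0Pn; exists i; rewrite inE.
have W0 : aug_ideal C m.+1 != 0.
  apply/eqP => W0; have := monS _ (s10 ord0).
  by rewrite W0 submx0 (negbTE (mon0 _)).
have [u [mu [[v vW vu] umu]]] := common_functional W0
    (aug_ideal_stable b) (var_mx_comm b).
pose phi (v : 'rV[C]_#|{set 'I_m.+1}|) : C := (v *m u) 0 0.
have phiE w : w *m u = (phi w)%:M.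
  by apply/matrixP => a c; rewrite !ord1 [RHS]mxE eqxx mulr1n.
have phiM i w : (w <= aug_ideal C m.+1)%MS ->
    phi (w *m var_mx b i) = mu i * phi w.
  by move=> wW; rewrite /phi umu // mxE.
have phi_sum i w : phi (w *m \sum_j b i j *: var_mx b j) =
    \sum_j b i j * phi (w *m var_mx b j).
  rewrite /phi mulmx_sumr mulmx_suml summxE; apply: eq_bigr => j _.
  by rewrite -scalemxAr -scalemxAl mxE.
have phiv : phi v != 0.
  by apply: contraNneq vu => vu0; rewrite phiE vu0 raddf0.
exists (\row_i mu i); last first.
  move=> i; rewrite mxE; apply: (mulIf phiv).
  have := congr1 (fun A => phi (v *m A)) (var_mx_sqr b i).
  have vMW : (v *m var_mx b i <= aug_ideal C m.+1)%MS.
    exact: submx_trans (submxMr _ vW) (aug_ideal_stable b i).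
  rewrite /= phi_sum mulmxA !phiM // mulrA -expr2 => ->.
  by rewrite mulr_suml; apply: eq_bigr => j _; rewrite mxE phiM // mulrA.
apply: contraNneq phiv => mu0.
have mu0i i : mu i = 0 by have /rowP/(_ i) := mu0; rewrite !mxE.
(* If all eigenvalues vanish, then 0 = phi(x_i^2) = \sum_j b_ij phi(x_j), and invertibility of [b]
   kills every phi(x_j). *)
have phi1 : \col_i phi (mon C [set i]) = 0.
  apply: (can_inj (mulKmx bU)); rewrite mulmx0.
  apply/matrixP => i c; rewrite !mxE.
  have := phiM i _ (monS _ (s10 i)); rewrite mu0i mul0r.
  rewrite (mon_setD1 b (set11 i)) setDv -mulmxA var_mx_sqr phi_sum => {2}<-.
  apply: eq_bigr => j _; rewrite mxE mon_var_notin ?inE //.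
  by rewrite setU0.
have phiS S : S != set0 -> phi (mon C S) = 0.
  move=> /set0Pn[i iS]; have [S1|S1] := eqVneq (S :\ i) set0.
    have -> : S = [set i] by rewrite -(setD1K iS) S1 setU0.
    by have /matrixP/(_ i 0) := phi1; rewrite !mxE.
  by rewrite (mon_setD1 b iS) phiM ?monS // mu0i mul0r.
have : (v <= kermx u)%MS.
  apply: submx_trans vW _; apply/sumsmx_subP => S S0; rewrite genmxE.
  by apply/sub_kermxP; rewrite phiE phiS // raddf0.
by move/sub_kermxP; rewrite phiE => /matrixP/(_ 0 0); rewrite !mxE mulr1n => ->.
Qed.

(** When the rows of [A] are the squares of a natural basis, [sqr_row x *m A] is the square of
    [x]. *)
Definition sqr_row (F : fieldType) m (x : 'rV[F]_m) : 'rV[F]_m :=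
  \row_i (x 0 i ^+ 2).

Lemma ex_idempotent (C : numClosedFieldType) m (A : 'M[C]_m) :
  (0 < m)%N -> A \in unitmx ->
  exists2 x : 'rV[C]_m, x != 0 & sqr_row x *m A = x.
Proof.
move=> m0 AU; have bU : (invmx A)^T \in unitmx by rewrite unitmx_tr unitmx_inv.
have [x x0 xE] := quadratic_system m0 bU; exists x => //.
apply: (canLR (mulmxKV AU)); apply/rowP => i; rewrite !mxE xE.
by apply: eq_bigr => j _; rewrite mxE mulrC.
Qed.

Lemma ex_quadratic_root (C : numClosedFieldType) (a c : C) : a != 0 ->
  exists2 t : C, t != 0 & c + a * t ^+ 2 = t.
Proof.
move=> a0; have [->|c0] := eqVneq c 0.
  by exists a^-1; rewrite ?invr_neq0 // add0r expr2 mulrA divff // mul1r.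
pose p : {poly C} := a *: 'X^2 - 'X + c%:P.
have pE t : p.[t] = c + a * t ^+ 2 - t.
  by rewrite !hornerE addrC addrA.
have p2 : p`_2 = a by rewrite !coefE /= mulr1 subr0 addr0.
have /closed_rootP[t /rootP tE] : size p != 1%N.
  apply: contra_neq a0 => sp.
  by rewrite -p2 nth_default ?sp.
exists t.
  apply: contraNneq c0 => t0; move: tE.
  by rewrite pE t0 expr2 !mulr0 addr0 subr0 => ->.
by apply/eqP; rewrite -subr_eq0 -pE tE.
Qed.

(** If a nonzero idempotent is supported on a single i, then row i of [A] vanishes off the diagonal
    and deleting row and column i leaves an invertible matrix. A nonzero idempotent of the smaller
    system lifts: only coordinate i remains, subject to a quadratic equation with a nonzero root. *)
Lemma ex_idempotent_supp2 (C : numClosedFieldType) m (A : 'M[C]_m) :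
  (1 < m)%N -> A \in unitmx ->
  exists2 x : 'rV[C]_m, sqr_row x *m A = x &
    exists i j, [/\ i != j, x 0 i != 0 & x 0 j != 0].
Proof.
case: m A => // m A m0 AU; have [x x0 xE] := ex_idempotent (ltn0Sn m) AU.
have /rV0Pn[i xi] := x0.
have [/existsP[j /andP[ji xj]]|] := boolP [exists j, (j != i) && (x 0 j != 0)].
  by exists x => //; exists j, i.
rewrite negb_exists => /forallP xij.
have xj0 j : j != i -> x 0 j = 0.
  by move=> ji; have := xij j; rewrite ji /= negbK => /eqP.
have Ai j : x 0 i ^+ 2 * A i j = x 0 j.
  rewrite -[in RHS]xE mxE (bigD1 i) //= big1 ?addr0 ?mxE // => k ki.
  by rewrite mxE xj0 // expr2 !mul0r.
have Aij j : j != i -> A i j = 0.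
  move=> ji; apply/eqP; have /eqP := Ai j.
  by rewrite (xj0 j ji) mulf_eq0 expf_eq0 (negbTE xi).
have Aii : A i i != 0.
  by apply: contraNneq xi => Aii; rewrite -Ai Aii mulr0.
pose A' := row' i (col' i A).
have A'U : A' \in unitmx.
  move: AU; rewrite !unitmxE (expand_det_row _ i) (bigD1 i) //= big1 ?addr0.
    rewrite unitrM /cofactor unitrM => /and3P[_ _].
    by rewrite unitfE.
  by move=> j ji; rewrite Aij // mul0r.
have [y y0 yE] := ex_idempotent m0 A'U.
have [t t0 tE] :=
  ex_quadratic_root (\sum_k y 0 k ^+ 2 * A (lift i k) i) Aii.
pose z : 'rV[C]_m.+1 := \row_j (if unlift i j is Some k then y 0 k else t).
have zi : z 0 i = t by rewrite mxE unlift_none.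
have zl k : z 0 (lift i k) = y 0 k by rewrite mxE liftK.
exists z.
  apply/rowP => j; rewrite mxE (bigD1_ord i) //= mxE zi.
  under eq_bigr do rewrite mxE zl.
  case: (unliftP i j) => [k|] ->; last by rewrite zi addrC mulrC -[RHS]tE mulrC.
  rewrite zl Aij 1?eq_sym ?neq_lift // mulr0 add0r -[in RHS]yE mxE.
  by apply: eq_bigr => l _; rewrite !mxE.
have /rV0Pn[k yk] := y0.
by exists i, (lift i k); rewrite zi zl neq_lift.
Qed.

(** * Powers, derived series and right powers *)

Section Product.
Variables (F : fieldType) (n : nat) (mu : alg F n).
Implicit Types (x y z : 'rV[F]_n) (A B C S : 'M[F]_n).

Local Notation "x ** y" := (amul mu x y) (at level 40, left associativity).

Lemma amulDl x y z : (x + y) ** z = x ** z + y ** z.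
Proof.
rewrite /amul -big_split; apply: eq_bigr => i _ /=.
rewrite -big_split; apply: eq_bigr => j _ /=.
by rewrite mxE mulrDl scalerDl.
Qed.

Lemma amulDr x y z : z ** (x + y) = z ** x + z ** y.
Proof.
rewrite /amul -big_split; apply: eq_bigr => i _ /=.
rewrite -big_split; apply: eq_bigr => j _ /=.
by rewrite mxE mulrDr scalerDl.
Qed.

Lemma amulZl a x y : (a *: x) ** y = a *: (x ** y).
Proof.
rewrite /amul scaler_sumr; apply: eq_bigr => i _ /=.
rewrite scaler_sumr; apply: eq_bigr => j _ /=.
by rewrite mxE -mulrA scalerA.
Qed.

Lemma amulZr a x y : x ** (a *: y) = a *: (x ** y).
Proof.
rewrite /amul scaler_sumr; apply: eq_bigr => i _ /=.
rewrite scaler_sumr; apply: eq_bigr => j _ /=.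
by rewrite mxE mulrCA scalerA.
Qed.

Lemma amul0l x : 0 ** x = 0.
Proof. by have := amulZl 0 0 x; rewrite !scale0r. Qed.

Lemma amul0r x : x ** 0 = 0.
Proof. by have := amulZr 0 x 0; rewrite !scale0r. Qed.

Lemma amulNr x y : x ** (- y) = - (x ** y).
Proof. by rewrite -scaleN1r amulZr scaleN1r. Qed.

Lemma amulNl x y : (- x) ** y = - (x ** y).
Proof. by rewrite -scaleN1r amulZl scaleN1r. Qed.

Lemma amulBr x y z : z ** (x - y) = z ** x - z ** y.
Proof. by rewrite amulDr amulNr. Qed.

Lemma amulBl x y z : (x - y) ** z = x ** z - y ** z.
Proof. by rewrite amulDl amulNl. Qed.

Lemma amul_suml I (r : seq I) (P : pred I) (f : I -> 'rV_n) y :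
  (\sum_(i <- r | P i) f i) ** y = \sum_(i <- r | P i) f i ** y.
Proof. by apply: (big_morph (amul mu ^~ y)) => [? ?|]; rewrite (amulDl, amul0l). Qed.

Lemma amul_sumr I (r : seq I) (P : pred I) (f : I -> 'rV_n) x :
  x ** (\sum_(i <- r | P i) f i) = \sum_(i <- r | P i) x ** f i.
Proof. by apply: (big_morph (amul mu x)) => [? ?|]; rewrite (amulDr, amul0r). Qed.

Lemma amul_rows m k (P : 'M_(m, n)) (Q : 'M_(k, n)) c d :
  (c *m P) ** (d *m Q) =
  \sum_i \sum_j (c 0 i * d 0 j) *: (row i P ** row j Q).
Proof.
rewrite !mulmx_sum_row amul_suml; apply: eq_bigr => i _.
rewrite amul_sumr; apply: eq_bigr => j _.
by rewrite amulZl amulZr scalerA.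
Qed.

Lemma prodsp_mul A B x y : (x <= A -> y <= B -> x ** y <= prodsp mu A B)%MS.
Proof.
move=> /submxP[c ->] /submxP[d ->]; rewrite amul_rows.
rewrite summx_sub // => i _; rewrite summx_sub // => j _; rewrite scalemx_sub //.
by rewrite (sumsmx_sup i) // (sumsmx_sup j) // genmxE.
Qed.

Lemma prodsp_sub q A B (C : 'M_(q, n)) :
  (forall x y, x <= A -> y <= B -> x ** y <= C)%MS -> (prodsp mu A B <= C)%MS.
Proof.
move=> ABC; apply/sumsmx_subP => i _; apply/sumsmx_subP => j _.
by rewrite genmxE ABC ?row_sub.
Qed.

Lemma prodspS A A' B B' :
  (A <= A' -> B <= B' -> prodsp mu A B <= prodsp mu A' B')%MS.
Proof.
by move=> AA BB; apply: prodsp_sub => x y xA yB; rewrite prodsp_mul //;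
  [apply: submx_trans AA | apply: submx_trans BB].
Qed.

Lemma subalgebra_prodsp S : subalgebra mu S <-> (prodsp mu S S <= S)%MS.
Proof.
split=> [sS|sS x y xS yS]; first by apply: prodsp_sub => x y; apply: sS.
by apply: submx_trans sS; apply: prodsp_mul.
Qed.

(** Indices start at 0: [der k] lies in E^(2^k), and [rpow k] lies in E^(k+1). *)
Fixpoint der k : 'M[F]_n :=
  if k is k'.+1 then prodsp mu (der k') (der k') else 1%:M.

Fixpoint rpow k : 'M[F]_n :=
  if k is k'.+1 then prodsp mu (rpow k') 1%:M else 1%:M.

Lemma der_subS k : (der k.+1 <= der k)%MS.
Proof. by elim: k => [|k IH]; rewrite ?submx1 // prodspS. Qed.

Lemma der_subalgebra k : subalgebra mu (der k).
Proof. exact/subalgebra_prodsp/der_subS. Qed.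

Lemma rpow_subS k : (rpow k.+1 <= rpow k)%MS.
Proof. by elim: k => [|k IH]; rewrite ?submx1 // prodspS. Qed.

Lemma size_epows k : size (epows mu k) = k.
Proof. by elim: k => //= k IH; rewrite size_rcons IH. Qed.

Lemma nth_epows k i : (i < k)%N -> nth 0 (epows mu k) i = epow mu i.+1.
Proof.
elim: k => // k IH; rewrite ltnS /= nth_rcons size_epows leq_eqVlt.
case/predU1P => [->|ik]; last by rewrite ik IH.
by rewrite ltnn eqxx /epow /= last_rcons.
Qed.

Lemma epow1 : epow mu 1 = 1%:M. Proof. by []. Qed.

Lemma epowsSS m : epows mu m.+2 = rcons (epows mu m.+1)
  (\sum_(i < m.+1) prodsp mu (epows mu m.+1)`_i (epows mu m.+1)`_(m.+1 - 1 - i))%MS.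
Proof. by []. Qed.

Lemma epowS m : (0 < m)%N ->
  epow mu m.+1 = (\sum_(i < m) prodsp mu (epow mu i.+1) (epow mu (m - i)))%MS.
Proof.
case: m => // m _; rewrite {1}/epow epowsSS last_rcons.
rewrite subn1 -[m.+1.-1]/m.
apply: eq_bigr => i _; rewrite !nth_epows //; last by rewrite ltnS leq_subr.
by rewrite -subSn // -ltnS.
Qed.

Lemma epow_mul a b x y : (0 < a)%N -> (0 < b)%N ->
  (x <= epow mu a -> y <= epow mu b -> x ** y <= epow mu (a + b))%MS.
Proof.
case: a => // a _ b0 xa yb; rewrite addSn epowS ?addn_gt0 ?b0 ?orbT //.
have ab : (a < a + b)%N by rewrite -[X in (X < _)%N]addn0 ltn_add2l.
rewrite (sumsmx_sup (Ordinal ab)) //= prodsp_mul //.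
by rewrite addnC addnK.
Qed.

Lemma epow_subP m C : (0 < m)%N ->
  (forall a b x y, (0 < a)%N -> (0 < b)%N -> (a + b)%N = m.+1 ->
     x <= epow mu a -> y <= epow mu b -> x ** y <= C)%MS ->
  (epow mu m.+1 <= C)%MS.
Proof.
move=> m0 H; rewrite epowS //; apply/sumsmx_subP => i _.
apply: prodsp_sub => x y xi yi; apply: H xi yi => //.
  by rewrite subn_gt0.
by rewrite addSn subnKC // ltnW.
Qed.

(** In a product E^a E^b with a + b > 2 one exponent is at least 2, and by induction that factor
    lies in the power one lower. *)
Lemma epow_subS m : (0 < m)%N -> (epow mu m.+1 <= epow mu m)%MS.
Proof.
elim: {m}_.+1 {-2}m (ltnSn m) => // k IH m; rewrite ltnS => mk m0.
case: m m0 mk => // -[_ _|m _ mk]; first by rewrite epow1 submx1.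
apply: epow_subP => // -[|[|a]] // b x y _ b0 abm xa yb.
  case: b b0 abm yb => // -[|b] _ // abm yb.
  rewrite -[m.+2]/(1 + m.+1)%N epow_mul //.
  have -> : m.+1 = b.+1 by move: abm; rewrite !add1n => -[->].
  apply: submx_trans yb _; apply: IH => //.
  by move: abm mk; rewrite !add1n => -[->].
have -> : m.+2 = (a.+1 + b)%N by move: abm; rewrite !addSn => -[->].
rewrite epow_mul //; apply: submx_trans xa _; apply: IH => //.
apply: leq_trans mk; move: abm; rewrite !addSn => -[<-].
by rewrite ltnS -[X in (X < _)%N]addn0 ltn_add2l.
Qed.

Lemma epow_sub j k : (0 < j)%N -> (j <= k)%N -> (epow mu k <= epow mu j)%MS.
Proof.
move=> j0; elim: k => [|k IH]; first by rewrite leqNgt j0.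
rewrite leq_eqVlt => /predU1P[->//|]; rewrite ltnS => jk.
apply: submx_trans (IH jk); apply: epow_subS.
exact: leq_trans jk.
Qed.

(* In a product of m factors one of the two outer factors has at least m/2 of
   them, so each doubling of m gains one step along a central chain. *)
Lemma epow_chain (W : nat -> 'M[F]_n) m k :
  (1%:M <= W 0)%MS ->
  (forall k x y, x <= W k -> x ** y <= W k.+1 /\ y ** x <= W k.+1)%MS ->
  (0 < m)%N -> (2 ^ k < m.*2)%N -> (epow mu m <= W k)%MS.
Proof.
move=> W0 WS; elim: {m}_.+1 {-2}m (ltnSn m) k => // h IH m.
rewrite ltnS => mh [|k] m0 mk; first by apply: submx_trans W0; apply: submx1.
case: m m0 mk mh => // -[_|m _ mk mh].
  by rewrite expnS -[1.*2]/(2 * 1)%N ltn_pmul2l // ltnNge expn_gt0.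
apply: epow_subP => // a b x y a0 b0 abm xa yb.
move: mk; rewrite -abm expnS -mul2n ltn_pmul2l // => kab.
have [ab|ab] := leqP a b.
  have yk : (y <= W k)%MS.
    apply: submx_trans yb _; apply: IH => //.
      by apply: leq_trans mh; rewrite -abm -add1n leq_add2r.
    by apply: leq_trans kab _; rewrite -addnn leq_add2r.
  by case: (WS k y x yk).
have xk : (x <= W k)%MS.
  apply: submx_trans xa _; apply: IH => //.
    by apply: leq_trans mh; rewrite -abm -addn1 leq_add2l.
  by apply: leq_trans kab _; rewrite -addnn leq_add2l ltnW.
by case: (WS k x y xk).
Qed.

Lemma der_epow k : (der k <= epow mu (2 ^ k))%MS.
Proof.
elim: k => [|k IH]; first by rewrite epow1.
apply: prodsp_sub => x y xk yk; rewrite expnS mul2n -addnn.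
by apply: epow_mul; rewrite ?expn_gt0 //; apply: submx_trans IH.
Qed.

Lemma rpow_epow k : (rpow k <= epow mu k.+1)%MS.
Proof.
elim: k => [|k IH]; first by rewrite epow1.
apply: prodsp_sub => x y xk yk; rewrite -[k.+2]addn1 epow_mul //.
exact: submx_trans IH.
Qed.

Lemma nil_index_ex : nilpotent mu -> exists k, nil_index mu k.
Proof.
move=> [k [k0 kE]].
have ex : exists k, (0 < k)%N && (epow mu k == 0).
  by exists k; rewrite k0 kE eqxx.
exists (ex_minn ex); case: ex_minnP => j /andP[j0 /eqP jE] jmin; split=> //.
by move=> i i0; apply: contraTneq => iE; rewrite -leqNgt jmin // i0 iE eqxx.
Qed.

Lemma nil_index_le k j :
  nil_index mu k -> (0 < j)%N -> epow mu j = 0 -> (k <= j)%N.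
Proof.
move=> [_ _ kmin] j0 jE; rewrite leqNgt; apply/negP => jk.
by have := kmin j j0 jk; rewrite jE eqxx.
Qed.

Lemma nil_index_gt k j :
  nil_index mu k -> (0 < j)%N -> epow mu j != 0 -> (j < k)%N.
Proof.
move=> [k0 kE _] j0; rewrite ltnNge; apply: contraNN => kj.
by rewrite -submx0 -kE epow_sub.
Qed.

End Product.

(** * The maximal nilpotency index *)

Definition acomm (F : fieldType) n (mu : alg F n) :=
  forall x y, amul mu x y = amul mu y x.

Lemma amul_delta (F : fieldType) n (mu : alg F n) i j :
  amul mu (delta_mx 0 i) (delta_mx 0 j) = mu i j.
Proof.
rewrite /amul (bigD1 i) //= (bigD1 j) //= !mxE !eqxx mulr1 scale1r.
rewrite big1 ?addr0 => [|k /negbTE kj]; last by rewrite !mxE kj mulr0 scale0r.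
rewrite big1 ?addr0 // => k /negbTE ki; rewrite big1 // => l _.
by rewrite !mxE ki mul0r scale0r.
Qed.

Lemma evolution_acomm (F : fieldType) n (mu : alg F n) :
  evolution mu -> acomm mu.
Proof.
move=> [B [BU B0]] x y; rewrite -(mulmxKV BU x) -(mulmxKV BU y) !amul_rows.
rewrite exchange_big; apply: eq_bigr => j _; apply: eq_bigr => i _ /=.
rewrite mulrC; have [->//|ij] := eqVneq i j.
by rewrite !B0 // eq_sym.
Qed.

Section Nilpotent.
Variables (F : fieldType) (n : nat) (mu : alg F n).
Hypothesis mu_comm : acomm mu.

Lemma rpow_stable k j :
  (rpow mu k <= rpow mu k.+1)%MS -> (rpow mu k <= rpow mu (k + j))%MS.
Proof.
move=> kS; elim: j => [|j IH]; first by rewrite addn0.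
by apply: submx_trans kS _; rewrite addnS; apply: prodspS.
Qed.

Lemma rpow_stable0 k :
  nilpotent mu -> (rpow mu k <= rpow mu k.+1)%MS -> rpow mu k = 0.
Proof.
move=> [m [m0 mE]] /(rpow_stable m) kS; apply/eqP; rewrite -submx0 -mE.
apply: submx_trans kS _; apply: submx_trans (rpow_epow mu _) _.
by apply: epow_sub => //; rewrite leqW // leq_addl.
Qed.

(** In a nilpotent algebra a right power equal to its successor is zero, so the rank drops at every
    step until it reaches 0. *)
Lemma rank_rpow k j : nilpotent mu ->
  (\rank (rpow mu (k + j)) <= \rank (rpow mu k) - j)%N.
Proof.
move=> nil; elim: j => [|j IH]; first by rewrite addn0 subn0.
have [r0|r0] := eqVneq (rpow mu (k + j)) 0.
  have : (rpow mu (k + j.+1) <= rpow mu (k + j))%MS by rewrite addnS rpow_subS.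
  by rewrite r0 submx0 => /eqP->; rewrite mxrank0.
rewrite subnS -ltnS; apply: leq_ltn_trans (leqSpred _).
rewrite -ltnS prednK; last first.
  by apply: leq_trans IH; rewrite lt0n mxrank_eq0.
apply: leq_trans IH; rewrite addnS ltn_neqAle mxrankS ?rpow_subS // andbT.
apply: contra r0 => rE; apply/eqP; apply: rpow_stable0 => //.
by rewrite -(mxrank_leqif_sup (rpow_subS _ _)).
Qed.

Lemma epow_eq0 k r m : nilpotent mu -> (\rank (rpow mu k) <= r)%N ->
  (0 < m)%N -> (2 ^ (k + r) < m.*2)%N -> epow mu m = 0.
Proof.
move=> nil kr m0 mk; have rE : rpow mu (k + r) = 0.
  apply/eqP; rewrite -mxrank_eq0 -leqn0; apply: leq_trans (rank_rpow _ _ nil) _.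
  by rewrite leqn0 subn_eq0.
apply/eqP; rewrite -submx0 -rE; apply: epow_chain m0 mk => // h x y xh.
by split; [|rewrite mu_comm]; apply: prodsp_mul; rewrite ?submx1.
Qed.

(** By commutativity the right powers form a central chain; it dies after at most n = s + 1 steps,
    and 2^s + 1 is the least m with 2^n < 2m. *)
Lemma nil_index_ub k s :
  n = s.+1 -> nil_index mu k -> (k <= (2 ^ s).+1)%N.
Proof.
move=> ns kP; apply: (nil_index_le kP) => //.
have nil : nilpotent mu by case: kP => k0 kE _; exists k.
apply: (@epow_eq0 0 n) => //=; first by rewrite mxrank1.
by rewrite add0n ns expnS mul2n ltn_double.
Qed.
End Nilpotent.

(** * An evolution algebra attaining the bound on the nilpotency index *)

Section ChainAlgebra.
Variables (F : fieldType) (s : nat).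

(** The last basis vector squares to zero, since no index equals s; iterated squaring of the first
    one runs through the whole basis. *)
Definition chain_alg : alg F s :=
  fun i j => if i == j then \row_(k < s) (k == i.+1 :> nat)%:R else 0.

Lemma chain_evolution : evolution chain_alg.
Proof.
exists 1%:M; split=> [|i j ij]; first exact: unitmx1.
by rewrite !rowE !mulmx1 amul_delta /chain_alg (negbTE ij).
Qed.

Let W k : 'M[F]_s := diag_mx (\row_(i < s) (k <= i)%:R).

Let W_P k (x : 'rV_s) :
  reflect (forall i : 'I_s, (i < k)%N -> x 0 i = 0) (x <= W k)%MS.
Proof.
apply: (iffP idP) => [/submxP[c ->] i ik|x0].
  by rewrite mul_mx_diag !mxE leqNgt ik mulr0.
suff -> : x = x *m W k by apply: submxMl.
apply/rowP => i; rewrite mul_mx_diag !mxE.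
by case: leqP => [_|/x0->]; rewrite ?mulr1 ?mul0r.
Qed.

Lemma chain_nilpotent : nilpotent chain_alg.
Proof.
exists (2 ^ s)%N; rewrite expn_gt0; split=> //; apply/eqP; rewrite -submx0.
have -> : 0 = W s.
  apply/matrixP => i j; rewrite !mxE leqNgt ltn_ord.
  by rewrite mul0rn.
apply: epow_chain; rewrite ?expn_gt0 //.
- by apply/row_subP => i; apply/W_P.
- move=> k x y /W_P xk; split; apply/W_P => i ik;
    rewrite /amul summxE big1 // => a _; rewrite summxE big1 // => b _;
    rewrite /chain_alg; case: (eqVneq a b) => [<-|]; rewrite ?scaler0 !mxE //;
    case: eqP => [ia|]; rewrite ?mulr0 // xk ?mulr0 ?mul0r //; 
    by rewrite ia ltnS in ik.
- by rewrite -addnn -[X in (X < _)%N]addn0 ltn_add2l expn_gt0.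
Qed.

Lemma chain_delta (k : 'I_s) : ((delta_mx 0 k : 'rV_s) <= epow chain_alg (2 ^ k))%MS.
Proof.
case: k => k ks /=; elim: k ks => [|k IH] ks; first by rewrite epow1 submx1.
have -> : delta_mx 0 (Ordinal ks) = amul chain_alg
    (delta_mx 0 (Ordinal (ltnW ks))) (delta_mx 0 (Ordinal (ltnW ks))).
  by rewrite amul_delta /chain_alg eqxx; apply/rowP => i; rewrite !mxE.
by rewrite expnS mul2n -addnn epow_mul ?expn_gt0.
Qed.
End ChainAlgebra.

(** Maximality allows comparison with the chain algebra, whose last basis vector is a nonzero
    element of the power 2^s. *)
Lemma max_nil_index_gt (F : fieldType) s (mu : alg F s.+1) :
  max_nil_index mu -> exists2 k, nil_index mu k & (2 ^ s < k)%N.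
Proof.
move=> [_ [k [kP kmax]]]; exists k => //.
have [j jP] := nil_index_ex (@chain_nilpotent F s.+1).
apply: leq_trans (kmax _ _ (chain_evolution F s.+1) jP).
apply: nil_index_gt jP _ _; rewrite ?expn_gt0 //.
apply/negP => /eqP e0; have := @chain_delta F s.+1 ord_max.
rewrite e0 submx0 => /eqP/rowP/(_ ord_max)/eqP.
by rewrite !mxE !eqxx oner_eq0.
Qed.

Lemma max_nil_index_nilpotent (F : fieldType) s (mu : alg F s) :
  max_nil_index mu -> nilpotent mu.
Proof. by move=> [_ [k [[k0 kE _] _]]]; exists k. Qed.

(** If the square had codimension two or more, the right powers would die a step earlier and the
    index would be at most 2^s + 1, too small in dimension s + 2. *)
Lemma max_nil_index_rank (F : fieldType) s (mu : alg F s.+2) :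
  max_nil_index mu -> (s < \rank (rpow mu 1))%N.
Proof.
move=> mumax; have nil := max_nil_index_nilpotent mumax.
have com : acomm mu by case: mumax => /evolution_acomm.
rewrite ltnNge; apply/negP => rs.
have [k kP] := max_nil_index_gt mumax; rewrite ltnNge => /negP; apply.
apply: leq_trans (nil_index_le kP (ltn0Sn (2 ^ s)) _) _.
  by apply: epow_eq0 rs _ _ => //; rewrite add1n expnS mul2n ltn_double.
by rewrite expnS mul2n -addnn -addn1 leq_add2l expn_gt0.
Qed.

(** An annihilating [z] outside the square would span the algebra together with it, as the
    codimension is one. Then E E = E^2 E, so the right powers stabilise and E^2 = 0, against its
    positive rank. *)
Lemma max_nil_index_ann (F : fieldType) s (mu : alg F s) z :
  (1 < s)%N -> max_nil_index mu -> (forall y, amul mu z y = 0) ->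
  (z <= rpow mu 1)%MS.
Proof.
case: s mu z => [|[|s]] // mu z _ mumax z0.
have nil := max_nil_index_nilpotent mumax.
have com : acomm mu by case: mumax => /evolution_acomm.
have rk := max_nil_index_rank mumax.
apply: contraT => zr; have full : (1%:M <= z + rpow mu 1)%MS.
  rewrite sub1mx /row_full eqn_leq rank_leq_col /=.
  apply: leq_ltn_trans rk _; rewrite (ltn_leqif (mxrank_leqif_sup _)).
    by rewrite addsmx_sub submx_refl andbT.
  exact: addsmxSr.
suff : rpow mu 1 = 0 by move=> r0; rewrite r0 mxrank0 in rk.
apply: rpow_stable0 => //; apply: prodsp_sub => x y _ _.
have /sub_addsmxP[[a b] /= ->] := submx_trans (submx1 x) full.
rewrite amulDl -[a *m z]/(a *m z) [a]mx11_scalar mul_scalar_mx amulZl z0.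
by rewrite scaler0 add0r prodsp_mul ?submx1 ?submxMl.
Qed.

(** [der mu s] lies in the power 2^s, so the index exceeds 2^s and meets the bound of
    [nil_index_ub]. *)
Lemma max_nil_index_der (F : fieldType) s (mu : alg F s.+1) :
  evolution mu -> nilpotent mu -> der mu s != 0 -> max_nil_index mu.
Proof.
move=> ev nil ders; split=> //; have [k kP] := nil_index_ex nil.
exists k; split=> // mu' k' /evolution_acomm com' k'P.
apply: leq_trans (nil_index_ub com' erefl k'P) _.
apply: nil_index_gt kP _ _; rewrite ?expn_gt0 //.
apply: contra ders => /eqP e0; rewrite -submx0 -e0; exact: der_epow.
Qed.

(** * Homomorphisms, direct sums and the non-isomorphism statements *)

Section Homs.
Variable F : fieldType.

Definition ahom m k (mu1 : alg F m) (mu2 : alg F k) (f : 'M_(m, k)) :=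
  forall x y, amul mu1 x y *m f = amul mu2 (x *m f) (y *m f).

Lemma ahom_comp m k l (mu1 : alg F m) (mu2 : alg F k) (mu3 : alg F l) f g :
  ahom mu1 mu2 f -> ahom mu2 mu3 g -> ahom mu1 mu3 (f *m g).
Proof. by move=> fh gh x y; rewrite mulmxA fh gh !mulmxA. Qed.

Lemma alg_iso_sym m k (mu1 : alg F m) (mu2 : alg F k) :
  alg_iso mu1 mu2 -> alg_iso mu2 mu1.
Proof.
move=> [f [ffree ffull fh]]; exists (pinvmx f).
have [g gE] : exists g, g = pinvmx f by exists (pinvmx f).
rewrite -gE; have gf : g *m f = 1%:M by rewrite gE mulVpmx.
have fg : f *m g = 1%:M by rewrite gE mulmxVp.
split=> [||x y]; rewrite ?gE ?pinvmx_free ?pinvmx_full //.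
rewrite -gE -[x in LHS]mulmx1 -[y in LHS]mulmx1 -gf !mulmxA -fh.
by rewrite -mulmxA fg mulmx1.
Qed.

Lemma amul_zero_alg k x y : amul (zero_alg F k) x y = 0.
Proof. by rewrite /amul big1 // => i _; rewrite big1 // => j _; rewrite scaler0. Qed.

Lemma amul_idem1 x y : amul (idem1 F) x y = (x 0 0 * y 0 0)%:M.
Proof.
rewrite /amul !big_ord1; apply/matrixP => i j.
by rewrite !mxE !ord1 eqxx mulr1 mulr1n.
Qed.

Section Dsum.
Variables (m k : nat) (mu1 : alg F m) (mu2 : alg F k).

Definition dinl : 'M[F]_(m, m + k) := row_mx 1%:M 0.
Definition dinr : 'M[F]_(k, m + k) := row_mx 0 1%:M.
Definition dprl : 'M[F]_(m + k, m) := col_mx 1%:M 0.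
Definition dprr : 'M[F]_(m + k, k) := col_mx 0 1%:M.

Lemma dinlE p (x : 'M_(p, m)) : x *m dinl = row_mx x 0.
Proof. by rewrite mul_mx_row mulmx1 mulmx0. Qed.

Lemma dinrE p (x : 'M_(p, k)) : x *m dinr = row_mx 0 x.
Proof. by rewrite mul_mx_row mulmx1 mulmx0. Qed.

Lemma dprlE p (x : 'M_(p, m)) y : row_mx x y *m dprl = x.
Proof. by rewrite mul_row_col mulmx1 mulmx0 addr0. Qed.

Lemma dprrE p (x : 'M_(p, m)) y : row_mx x y *m dprr = y.
Proof. by rewrite mul_row_col mulmx1 mulmx0 add0r. Qed.

Lemma amul_dsum a b a' b' :
  amul (dsum mu1 mu2) (row_mx a b) (row_mx a' b') =
  row_mx (amul mu1 a a') (amul mu2 b b').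
Proof.
have sl i : split (lshift k i) = inl i := @unsplitK m k (inl i).
have sr i : split (rshift m i) = inr i := @unsplitK m k (inr i).
have -> : row_mx (amul mu1 a a') (amul mu2 b b') =
    amul mu1 a a' *m dinl + amul mu2 b b' *m dinr.
  by rewrite dinlE dinrE add_row_mx addr0 add0r.
rewrite [LHS]/amul big_split_ord /=; congr (_ + _).
  rewrite [in RHS]/amul mulmx_suml; apply: eq_bigr => i _.
  rewrite big_split_ord /= [X in _ + X]big1 ?addr0 => [|j _]; last first.
    by rewrite /dsum sl sr scaler0.
  rewrite mulmx_suml; apply: eq_bigr => j _; rewrite /dsum !sl !row_mxEl.
  by rewrite -scalemxAl dinlE.
rewrite [in RHS]/amul mulmx_suml; apply: eq_bigr => i _.
rewrite big_split_ord /= big1 ?add0r => [|j _]; last first.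
  by rewrite /dsum sl sr scaler0.
rewrite mulmx_suml; apply: eq_bigr => j _; rewrite /dsum !sr !row_mxEr.
by rewrite -scalemxAl dinrE.
Qed.

Lemma dsum_eq0 p (x : 'M_(p, m + k)) : x *m dprl = 0 -> x *m dprr = 0 -> x = 0.
Proof.
by rewrite -[x]hsubmxK dprlE dprrE => -> ->; rewrite row_mx0.
Qed.

Lemma dinl_hom : ahom mu1 (dsum mu1 mu2) dinl.
Proof. by move=> x y; rewrite !dinlE amul_dsum amul0l. Qed.

Lemma dinr_hom : ahom mu2 (dsum mu1 mu2) dinr.
Proof. by move=> x y; rewrite !dinrE amul_dsum amul0l. Qed.

Lemma dprl_hom : ahom (dsum mu1 mu2) mu1 dprl.
Proof.
move=> x y; rewrite -[x]hsubmxK -[y]hsubmxK.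
by rewrite amul_dsum !dprlE.
Qed.

Lemma dprr_hom : ahom (dsum mu1 mu2) mu2 dprr.
Proof.
move=> x y; rewrite -[x]hsubmxK -[y]hsubmxK.
by rewrite amul_dsum !dprrE.
Qed.

Lemma dsum_hom n (mu : alg F n) P Q :
  ahom mu1 mu P -> ahom mu2 mu Q ->
  (forall x y, amul mu (x *m P) (y *m Q) = 0) ->
  (forall x y, amul mu (y *m Q) (x *m P) = 0) ->
  ahom (dsum mu1 mu2) mu (col_mx P Q).
Proof.
move=> Ph Qh PQ QP x y; rewrite -[x]hsubmxK -[y]hsubmxK amul_dsum.
by rewrite !mul_row_col !amulDl !amulDr PQ QP Ph Qh addr0 add0r.
Qed.
End Dsum.

(** Iterated squares of an element eventually vanish in a nilpotent algebra, while their images are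
    powers of a scalar. *)
Lemma ahom_idem1_eq0 n (mu : alg F n) g :
  nilpotent mu -> ahom mu (idem1 F) g -> g = 0.
Proof.
move=> [m [m0 mE]] gh; apply/row_matrixP => i; rewrite row0 rowE.
move: (delta_mx 0 i) => x.
pose y k := iter k (fun z => amul mu z z) x.
have yder k : (y k <= der mu k)%MS.
  by elim: k => [|k IH]; [apply: submx1 | apply: prodsp_mul].
have yg k : (y k *m g) 0 0 = (x *m g) 0 0 ^+ (2 ^ k).
  elim: k => [|k IH]; first by rewrite expr1.
  rewrite /y iterS -/(y k) gh amul_idem1 mxE eqxx mulr1n IH.
  by rewrite -expr2 -exprM expnSr.
have ym : y m = 0.
  apply/eqP; rewrite -submx0 -mE; apply: submx_trans (yder m) _.
  by apply: submx_trans (der_epow _ _) _; rewrite epow_sub // ltnW // ltn_expl.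
apply/matrixP => a b; rewrite !ord1 [RHS]mxE; apply/eqP; have := yg m.
by rewrite ym mul0mx [LHS]mxE => /esym/eqP; rewrite expf_eq0 expn_gt0 => /andP[].
Qed.

(** [h] is the Et'-component of the isomorphism on Et; the idempotent component is zero because Et
    is nilpotent. If [h] kills [x], the image of [x] lies in the zero summand, so [x] annihilates Et
    and therefore lies in its square. Squares have no component in the zero summand, hence x = 0. *)
Lemma dsum_embedding s s' r r' (Et : alg F s) (Et' : alg F s') :
  (1 < s)%N -> max_nil_index Et ->
  alg_iso (dsum (idem1 F) (dsum Et (zero_alg F r)))
          (dsum (idem1 F) (dsum Et' (zero_alg F r'))) ->
  exists2 h, ahom Et Et' h & row_free h.
Proof.
move=> s1 Emax [f [ffree _ fh]].
have [i iE] : exists i, i = dinl s r *m dinr 1 _ *m f by eexists.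
have ih : ahom Et (dsum (idem1 F) (dsum Et' (zero_alg F r'))) i.
  rewrite iE; apply: ahom_comp fh.
  exact: ahom_comp (dinl_hom _ _) (dinr_hom _ _).
have i0 x : x *m i = 0 -> x = 0.
  rewrite iE mulmxA => /eqP; rewrite mulmx_free_eq0 // mulmxA dinlE dinrE.
  move/eqP => /(congr1 (fun z => z *m dprr _ _ *m dprl _ _)).
  by rewrite dprrE dprlE !mul0mx.
have chi0 : i *m dprl 1 _ = 0.
  apply: ahom_idem1_eq0 (max_nil_index_nilpotent Emax) _.
  exact: ahom_comp ih (dprl_hom _ _).
exists (i *m dprr 1 _ *m dprl s' r').
  apply: ahom_comp (dprl_hom _ (zero_alg F r')).
  exact: ahom_comp ih (dprr_hom _ _).
apply: inj_row_free => x; rewrite !mulmxA => xh.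
have xchi : x *m i *m dprl 1 _ = 0 by rewrite -mulmxA chi0 mulmx0.
have xann y : amul Et x y = 0.
  apply: i0; rewrite ih; apply: dsum_eq0.
    by rewrite dprl_hom xchi amul0l.
  rewrite dprr_hom; apply: dsum_eq0; first by rewrite dprl_hom xh amul0l.
  by rewrite dprr_hom amul_zero_alg.
have := max_nil_index_ann s1 Emax xann.
have E2 : (rpow Et 1 <= kermx (i *m dprr 1 _ *m dprr s' r'))%MS.
  apply: prodsp_sub => a b _ _; apply/sub_kermxP.
  have gh : ahom Et (zero_alg F r') (i *m dprr 1 _ *m dprr s' r').
    apply: ahom_comp (dprr_hom Et' _).
    exact: ahom_comp ih (dprr_hom _ _).
  by rewrite gh amul_zero_alg.
move=> /submx_trans/(_ E2)/sub_kermxP; rewrite !mulmxA => xz.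
by apply: i0; apply: dsum_eq0 => //; apply: dsum_eq0.
Qed.

(** Embeddings in both directions force s = s', which makes the embedding [h] bijective. *)
Lemma algB_inj n s s' (Et : alg F s) (Et' : alg F s') :
  (1 < s)%N -> (1 < s')%N -> max_nil_index Et -> max_nil_index Et' ->
  alg_iso (algB n Et) (algB n Et') -> alg_iso Et Et'.
Proof.
move=> s1 s1' Em Em' iso.
have [h hh hfree] := dsum_embedding s1 Em iso.
have [h' _ h'free] := dsum_embedding s1' Em' (alg_iso_sym iso).
exists h; split=> //; move: hfree h'free (rank_leq_col h) (rank_leq_col h').
by rewrite /row_free /row_full => /eqP-> /eqP-> ss' s's; rewrite eqn_leq ss'.
Qed.

(** All products in [algA] lie on one line. In an isomorphic [algB] that line would be spanned by
    the idempotent, so Et would have zero product, whereas its square has codimension at most one in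
    dimension at least two. *)
Lemma algA_not_algB n s (Et : alg F s) :
  (1 < s)%N -> max_nil_index Et -> ~ alg_iso (algA F n) (algB n Et).
Proof.
move=> s1 Em [f [_ ffull fh]].
pose e : 'rV[F]_(1 + (n - 1)) := row_mx 1%:M 0.
have sqA x y : exists a, amul (algA F n) x y = a *: e.
  exists ((lsubmx x) 0 0 * (lsubmx y) 0 0).
  rewrite -[x in LHS]hsubmxK -[y in LHS]hsubmxK.
  rewrite amul_dsum amul_zero_alg amul_idem1 scale_row_mx scaler0.
  by rewrite scalemx1.
have sqB x y : exists a, amul (algB n Et) x y = a *: (e *m f).
  have /submxP[x' ->] : (x <= f)%MS by apply: submx_full.
  have /submxP[y' ->] : (y <= f)%MS by apply: submx_full.
  by have [a aE] := sqA x' y'; exists a; rewrite -fh aE scalemxAl.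
pose g : 'rV[F]_(1 + (s + (n - s - 1))) := 1%:M *m dinl 1 _.
have [a gE] := sqB g g; rewrite -dinl_hom in gE.
have g0 : e *m f *m dprr 1 _ *m dprl _ _ = 0.
  have : amul (idem1 F) 1%:M 1%:M = 1%:M :> 'rV_1.
    by rewrite amul_idem1 !mxE mulr1.
  move=> id1; rewrite id1 in gE.
  have a0 : a != 0.
    apply/eqP => a0; move: gE; rewrite a0 scale0r.
    move=> /(congr1 (fun z => z *m dprl _ _)).
    rewrite dinlE dprlE mul0mx => /matrixP/(_ 0 0)/eqP.
    by rewrite !mxE oner_eq0.
  have -> : e *m f = a^-1 *: (1%:M *m dinl 1 _).
    by rewrite gE scalerA mulVf ?scale1r.
  by rewrite -!scalemxAl dinlE dprrE mul0mx scaler0.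
have E0 x y : amul Et x y = 0.
  have [b bE] := sqB (x *m dinl s _ *m dinr 1 _) (y *m dinl s _ *m dinr 1 _).
  have := congr1 (fun z => z *m dprr _ _ *m dprl _ _) bE.
  rewrite -dinr_hom -(dinl_hom Et (zero_alg F _)) dinrE dprrE dinlE dprlE.
  by rewrite -!scalemxAl g0 scaler0.
case: s s1 Et Em {f ffull fh sqB g a gE g0} E0 => [|[|s]] // _ Et Em E0.
have := max_nil_index_rank Em.
suff -> : rpow Et 1 = 0 by rewrite mxrank0.
by apply/eqP; rewrite -submx0; apply: prodsp_sub => x y _ _; rewrite E0 sub0mx.
Qed.
End Homs.

(** * Annihilating complements and the idempotent ideal *)

Definition ann_compl (F : fieldType) n (mu : alg F n) :=
  forall S, subalgebra mu S -> forall v, exists2 s, (s <= S)%MS &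
    forall x : 'rV_n, (x <= S)%MS -> amul mu x (v - s) = 0.

Section Subalgebras.
Variables (F : fieldType) (n : nat) (mu : alg F n).

Lemma sub_row_sums (I : {set 'I_n}) (B S : 'M[F]_n) (x : 'rV_n) :
  (S == \sum_(i in I) <<row i B>>)%MS -> (x <= S)%MS ->
  exists c : 'I_n -> F, x = \sum_(i in I) c i *: row i B.
Proof.
move=> /eqmxP SE; rewrite SE => /sub_sums_genmxP[u ->].
exists (fun i => u i 0 0); apply: eq_bigr => i _.
by rewrite {1}[u i]mx11_scalar mul_scalar_mx.
Qed.

(** Expand [v] in a natural basis extending one of [S]: the part outside [I] annihilates every basis
    vector of [S]. *)
Lemma complete_ann_compl : complete mu -> ann_compl mu.
Proof.
move=> cmu S /cmu[B [[BU B0] [I SE]]] v.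
have [c vE] : exists c : 'I_n -> F, v = \sum_i c i *: row i B.
  exists (fun i => (v *m invmx B) 0 i).
  by rewrite -[LHS](mulmxKV BU) mulmx_sum_row.
exists (\sum_(i in I) c i *: row i B).
  rewrite (eqmxP SE) summx_sub // => i iI.
  by rewrite scalemx_sub // (sumsmx_sup i) // genmxE.
move=> x /(sub_row_sums SE)[d ->].
have -> : v - \sum_(i in I) c i *: row i B =
    \sum_(i | i \notin I) c i *: row i B.
  by rewrite vE (bigID (mem I)) /= [X in X - _]addrC addrK.
rewrite amul_suml big1 // => i iI.
rewrite amul_sumr big1 // => j jI; rewrite amulZl amulZr B0 ?scaler0 //.
by apply: contraNneq jI => <-.
Qed.

Lemma complete_natural_basis S : complete mu -> subalgebra mu S ->
  exists r (P : 'M[F]_(r, n)), [/\ row_free P, (P :=: S)%MS &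
    forall i j, i != j -> amul mu (row i P) (row j P) = 0].
Proof.
move=> cmu /cmu[B [[BU B0] [I SE]]].
pose P := rowsub (@enum_val _ (mem I)) B.
have PS : (P :=: S)%MS.
  apply/eqmxP/andP; split.
    apply/row_subP => i; rewrite row_rowsub (eqmxP SE).
    by rewrite (sumsmx_sup (enum_val i)) ?enum_valP // genmxE.
  rewrite (eqmxP SE); apply/sumsmx_subP => i iI; rewrite genmxE.
  by rewrite -(enum_rankK_in iI iI) -row_rowsub row_sub.
have Pfree : row_free P.
  have : row_free B by rewrite row_free_unit.
  move/row_freeP => [G BG]; apply/row_freeP.
  exists (colsub (@enum_val _ (mem I)) G).
  rewrite mulmx_colsub mul_rowsub_mx BG; apply/matrixP => i j; rewrite !mxE.
  by rewrite (inj_eq enum_val_inj).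
exists #|I|, P; split=> // i j ij.
by rewrite !row_rowsub B0 // (inj_eq enum_val_inj).
Qed.

(** Coordinates are read off by [pinvmx P], which recovers the product only when the span of [P] is
    closed under it. *)
Definition sub_alg r (P : 'M[F]_(r, n)) : alg F r :=
  fun i j => amul mu (row i P) (row j P) *m pinvmx P.

Lemma sub_alg_hom r (P : 'M[F]_(r, n)) :
  (forall x y : 'rV_n, x <= P -> y <= P -> amul mu x y <= P)%MS ->
  ahom (sub_alg P) mu P.
Proof.
move=> Pc x y; rewrite amul_rows /amul mulmx_suml; apply: eq_bigr => i _.
rewrite mulmx_suml; apply: eq_bigr => j _; rewrite -scalemxAl mulmxKpV //.
by rewrite Pc ?row_sub.
Qed.

Section Restriction.
Variables (r : nat) (nu : alg F r) (P : 'M[F]_(r, n)).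
Hypotheses (Pfree : row_free P) (Phom : ahom nu mu P).

Let Pinj (x y : 'rV_r) : x *m P = y *m P -> x = y.
Proof. exact: row_free_inj. Qed.

Lemma acomm_sub : acomm mu -> acomm nu.
Proof. by move=> com x y; apply: Pinj; rewrite !Phom com. Qed.

(** The correcting vector [s] lies in the image of [S], hence in the subalgebra, so the property
    restricts. *)
Lemma ann_compl_sub : ann_compl mu -> ann_compl nu.
Proof.
move=> amu S sS v; have := amu <<S *m P>>%MS _ (v *m P); case.
  move=> x y; rewrite !genmxE => /submxP[a ->] /submxP[b ->].
  by rewrite !mulmxA -Phom submxMr // sS ?submxMl.
move=> s; rewrite genmxE => /submxP[c sE] s0; exists (c *m S).
  exact: submxMl.
move=> x xS; apply: Pinj; rewrite Phom mul0mx mulmxBl -mulmxA -sE s0 //.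
by rewrite genmxE submxMr.
Qed.

Lemma submx_preim q (X : 'M[F]_(q, n)) (A : 'M[F]_r) :
  (A *m P <= X)%MS = (A <= kermx (P *m cokermx X))%MS.
Proof. by rewrite submxE -mulmxA sub_kermx. Qed.

Lemma der_sub_alg k : (der nu k *m P <= der mu k)%MS.
Proof.
elim: k => [|k IH]; first exact: submx1.
rewrite submx_preim; apply: prodsp_sub => x y xk yk.
apply/sub_kermxP; rewrite mulmxA Phom; apply/eqP; rewrite -submxE.
by rewrite prodsp_mul // (submx_trans _ IH) // submxMr.
Qed.
End Restriction.
End Subalgebras.

(** * The derived series under annihilating complements *)

Section Complement.
Variables (F : fieldType) (n : nat) (mu : alg F n).
Hypotheses (mu_comm : acomm mu) (mu_compl : ann_compl mu).
Local Notation "x ** y" := (amul mu x y) (at level 40, left associativity).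
Implicit Types x y : 'rV[F]_n.

Lemma der_mul k x y : (x <= der mu k)%MS -> (x ** y <= der mu k.+1)%MS.
Proof.
move=> xk; have [s sk s0] := mu_compl (@der_subalgebra _ _ mu k) y.
by rewrite -[y](subrK s) amulDr s0 // add0r; apply: prodsp_mul.
Qed.

Lemma epow_der m k : (0 < m)%N -> (2 ^ k < m.*2)%N ->
  (epow mu m <= der mu k)%MS.
Proof.
move=> m0 mk; apply: epow_chain m0 mk => // h x y xh.
by split; [|rewrite mu_comm]; apply: der_mul.
Qed.

Lemma der_eq0_nilpotent k : der mu k = 0 -> nilpotent mu.
Proof.
move=> dk; exists (2 ^ k)%N; rewrite expn_gt0; split=> //.
apply/eqP; rewrite -submx0 -dk epow_der ?expn_gt0 //.
by rewrite -addnn -[X in (X < _)%N]addn0 ltn_add2l expn_gt0.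
Qed.

(** Correct the generator of D_k modulo D_(k+1) to some [t] annihilating D_(k+1); then D_k D_k is
    spanned by t^2 and D_(k+1) D_(k+1). *)
Lemma der_monogenic k :
  (exists t : 'rV_n, der mu k <= t + der mu k.+1)%MS ->
  exists t : 'rV_n, (der mu k.+1 <= t + der mu k.+2)%MS.
Proof.
move=> [y yE]; have [s sk s0] := mu_compl (@der_subalgebra _ _ mu k.+1) y.
have [t t0 tE] : exists2 t : 'rV_n,
    forall x, (x <= der mu k.+1)%MS -> x ** t = 0 &
    (der mu k <= t + der mu k.+1)%MS.
  exists (y - s) => //; apply: submx_trans yE _; rewrite addsmx_sub addsmxSr andbT.
  by rewrite -{1}[y](subrK s) addmx_sub_adds.
exists (t ** t); apply: prodsp_sub => u v uk vk.
have /sub_addsmxP[[a u'] /= uE] := submx_trans uk tE.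
have /sub_addsmxP[[b v'] /= vE] := submx_trans vk tE.
rewrite uE vE [a]mx11_scalar [b]mx11_scalar !mul_scalar_mx amulDl !amulDr.
rewrite !(amulZl, amulZr) [t ** (_ *m _)]mu_comm.
rewrite (t0 (u' *m _)) ?submxMl // (t0 (v' *m _)) ?submxMl //.
rewrite !scaler0 addr0 add0r scalerA; apply: addmx_sub_adds.
  by rewrite scalemx_sub.
by apply: prodsp_mul; apply: submxMl.
Qed.

(** Every quotient D_j / D_(j+1) is generated by one element, so each step loses at most one
    dimension. *)
Lemma der_rank k : (exists t : 'rV_n, 1%:M <= t + der mu 1)%MS ->
  (n - k <= \rank (der mu k))%N.
Proof.
move=> gen; have {gen} gen j :
    exists t : 'rV_n, (der mu j <= t + der mu j.+1)%MS.
  by elim: j => //= j IH; apply: der_monogenic.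
elim: k => [|k IH]; first by rewrite subn0 mxrank1.
rewrite subnS; have [t tk] := gen k.
have := leq_trans (leq_trans IH (mxrankS tk)) (mxrank_adds_leqif _ _).
move=> /leq_trans/(_ (leq_add (rank_leq_row t) (leqnn _))).
by rewrite add1n; case: (n - k)%N.
Qed.

Lemma der_stabilizes : exists k, (der mu k <= der mu k.+1)%MS.
Proof.
suff H : forall k, (exists k, (der mu k <= der mu k.+1)%MS) \/
    (\rank (der mu k) + k <= n)%N.
  by have [//|] := H n.+1; move/(leq_trans (leq_addl _ _)); rewrite ltnn.
elim=> [|k [IH|IH]]; [by right; rewrite mxrank1 addn0|by left|].
case: (boolP (der mu k <= der mu k.+1)%MS) => [dk|dk]; first by left; exists k.
right; apply: leq_trans IH; rewrite addnS ltn_add2r.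
by rewrite (ltn_leqif (mxrank_leqif_sup (der_subS mu k))).
Qed.
End Complement.

Lemma diag_alg_amul (F : fieldType) r (nu : alg F r) (x y : 'rV_r) :
  (forall i j, i != j -> nu i j = 0) ->
  amul nu x y = (\row_i (x 0 i * y 0 i)) *m (\matrix_i nu i i).
Proof.
move=> nu0; rewrite mulmx_sum_row; apply: eq_bigr => i _.
rewrite (bigD1 i) //= big1 ?addr0 => [|j ji].
  by rewrite mxE rowK.
by rewrite nu0 1?eq_sym // scaler0.
Qed.

(* An idempotent spans a subalgebra, whose annihilating complement would have to
   be supported off the idempotent, so an idempotent has support of size one. *)
Lemma perfect_ann_compl (C : numClosedFieldType) r (nu : alg C r) :
  (forall i j, i != j -> nu i j = 0) -> ann_compl nu ->
  \matrix_i nu i i \in unitmx -> (r <= 1)%N.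
Proof.
move=> nu0 nuc AU; rewrite leqNgt; apply/negP => r1.
have [x xE [i [j [ij xi xj]]]] := ex_idempotent_supp2 r1 AU.
have xx : amul nu x x = x by rewrite diag_alg_amul.
have := nuc <<x>>%MS _ (delta_mx 0 i); case.
  move=> y z; rewrite !genmxE => /sub_rVP[a ->] /sub_rVP[b ->].
  by rewrite amulZl amulZr xx !scalemx_sub.
move=> s; rewrite genmxE => /sub_rVP[a ->] /(_ x).
rewrite genmxE => /(_ (submx_refl _)).
rewrite diag_alg_amul // => /(congr1 (fun z => z *m invmx (\matrix_i nu i i))).
rewrite mul0mx mulmxK // => /rowP z0.
(* Invertibility makes the coordinatewise product of x with e_i - a x vanish. Coordinate j forces a
   = 0, and then coordinate i forces x_i = 0. *)
have := z0 j; rewrite !mxE eqxx eq_sym (negbTE ij) sub0r => /eqP.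
rewrite mulf_eq0 (negbTE xj) oppr_eq0 mulf_eq0 (negbTE xj) orbF /= => /eqP a0.
have := z0 i; rewrite !mxE !eqxx a0 mul0r subr0 mulr1 => /eqP.
by rewrite (negbTE xi).
Qed.

Lemma ex_idempotent_ideal (C : numClosedFieldType) n (mu : alg C n) :
  evolution mu -> complete mu -> ~ nilpotent mu ->
  exists k (e : 'rV_n), [/\ e != 0, amul mu e e = e & (der mu k :=: e)%MS].
Proof.
move=> ev cmu nnil; have com := evolution_acomm ev.
have acmu := complete_ann_compl cmu.
have [k dk] := der_stabilizes mu; exists k.
have d0 : der mu k != 0.
  by apply/eqP => d0; apply: nnil; apply: der_eq0_nilpotent d0.
have [r [P [Pfree PD P0]]] :=
  complete_natural_basis cmu (@der_subalgebra _ _ mu k).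
have rE : r = \rank (der mu k) by rewrite -PD (eqP Pfree).
have Phom : ahom (sub_alg mu P) mu P.
  by apply: sub_alg_hom => x y; rewrite !PD; apply: der_subalgebra.
have nu0 i j : i != j -> sub_alg mu P i j = 0.
  by move=> ij; rewrite /sub_alg P0 ?mul0mx.
pose A := \matrix_i sub_alg mu P i i.
(* Since D = D^2, the squares of the natural basis [P] span D. *)
have AU : A \in unitmx.
  rewrite -row_full_unit /row_full eqn_leq rank_leq_col /=.
  suff : (P <= A *m P)%MS.
    move=> /mxrankS /leq_trans/(_ (mxrankM_maxl _ _)).
    by rewrite (eqP Pfree).
  rewrite PD; apply: submx_trans dk _; apply: prodsp_sub => x y.
  rewrite -!PD => /submxP[a ->] /submxP[b ->].
  by rewrite -Phom diag_alg_amul // -mulmxA submxMl.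
have r1 := perfect_ann_compl nu0 (ann_compl_sub Pfree Phom acmu) AU.
pose p := nz_row (der mu k).
have p0 : p != 0 by rewrite nz_row_eq0.
have dp : (der mu k :=: p)%MS.
  apply/eqmxP; rewrite andbC nz_row_sub /=.
  rewrite -(mxrank_leqif_sup (nz_row_sub _)).
  rewrite eqn_leq mxrankS ?nz_row_sub //= -?rE ?(leq_trans r1) //.
  by rewrite lt0n mxrank_eq0.
have [a pp] : exists a, amul mu p p = a *: p.
  by apply/sub_rVP; rewrite -dp; apply: der_subalgebra; rewrite dp.
(* Otherwise D^2 = 0, against D^2 = D != 0; hence p / a is idempotent. *)
have a0 : a != 0.
  apply: contraNneq p0 => a0; rewrite -submx0 -dp; apply: submx_trans dk _.
  apply: prodsp_sub => x y; rewrite !dp => /sub_rVP[b ->] /sub_rVP[c ->].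
  by rewrite amulZl amulZr pp a0 scale0r !scaler0 sub0mx.
exists (a^-1 *: p); split.
- by rewrite scaler_eq0 invr_eq0 (negbTE a0).
- by rewrite amulZl amulZr pp [_ *: (a *: p)]scalerA mulVf // scale1r.
- by apply: eqmx_trans dp (eqmx_sym _); apply: eqmx_scale; rewrite invr_eq0.
Qed.

(** * The annihilator of the idempotent *)

Section Peirce.
Variables (C : numClosedFieldType) (n : nat) (mu : alg C n).
Hypotheses (com : acomm mu) (compl : ann_compl mu).
Variables (k : nat) (e : 'rV[C]_n).
Hypotheses (e0 : e != 0) (ee : amul mu e e = e) (dk : (der mu k :=: e)%MS).
Local Notation "x ** y" := (amul mu x y) (at level 40, left associativity).
Implicit Types x y z : 'rV[C]_n.

Definition lmul_mx x : 'M[C]_n := \matrix_j (x ** delta_mx 0 j).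

Lemma mul_lmul_mx x y : y *m lmul_mx x = x ** y.
Proof.
rewrite mulmx_sum_row [in RHS](row_sum_delta y) amul_sumr.
by apply: eq_bigr => j _; rewrite rowK amulZr.
Qed.

Definition peirce0 : 'M[C]_n := kermx (lmul_mx e).
Local Notation T := peirce0.

Lemma peirce0P x : reflect (e ** x = 0) (x <= T)%MS.
Proof. by apply: (iffP sub_kermxP); rewrite mul_lmul_mx. Qed.

Lemma e_notin : ~~ (e <= T)%MS.
Proof. by apply/peirce0P; rewrite ee; apply/eqP. Qed.

(** The line of [e] is D_k, and D_k E <= D_(k+1) <= D_k makes it an ideal. *)
Lemma e_mul x : exists a, e ** x = a *: e.
Proof.
apply/sub_rVP; rewrite -dk; apply: submx_trans (der_subS mu k).
by apply: der_mul => //; rewrite dk.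
Qed.

Lemma peirce_split x : exists a, (x - a *: e <= T)%MS.
Proof.
have [a ae] := e_mul x; exists a; apply/peirce0P.
by rewrite amulBr amulZr ee ae subrr.
Qed.

Lemma peirce_sum : (1%:M <= e + T)%MS.
Proof.
apply/row_subP => i; have [a aT] := peirce_split (row i 1%:M).
rewrite -[row _ _](subrK (a *: e)) addrC.
by apply: addmx_sub_adds; rewrite ?scalemx_sub.
Qed.

Lemma e_der j : (e <= der mu j)%MS.
Proof.
by elim: j => [|j IH]; [apply: submx1 | rewrite -ee; apply: prodsp_mul].
Qed.

(** Suppose x in S has e x = a e with a != 0. Some s in S makes e - s annihilate S, so a e = x s
    lies in S, a contradiction. *)
Lemma sub_peirce0 S : subalgebra mu S -> ~~ (e <= S)%MS -> (S <= T)%MS.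
Proof.
move=> sS eS; apply/row_subP => i; apply/peirce0P.
have [a ae] := e_mul (row i S); rewrite ae; have [->|a0] := eqVneq a 0.
  by rewrite scale0r.
case/negP: eS; have [s sS' s0] := compl sS e.
have := s0 _ (row_sub i S); rewrite amulBr => /eqP; rewrite subr_eq0 com ae.
move=> /eqP eE; rewrite -(scalerK a0 e) scalemx_sub // eE.
by apply: sS; rewrite ?row_sub.
Qed.

(* Adjoining to S a suitable t + c e, with t annihilating S and c^2 killing the
   e-component of t^2, yields a larger subalgebra that still misses e. *)
Lemma peirce0_extend S : subalgebra mu S -> (S <= T)%MS -> ~~ (T <= S)%MS ->
  exists S' : 'M[C]_n,
    [/\ subalgebra mu S', (S' <= T)%MS & (\rank S < \rank S')%N].
Proof.
move=> sS ST TS.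
(* Choose the least such index j + 1 and x in D_j and T but outside S. For t = x - s annihilating S,
   the product t t = x t falls into D_(j+1), so its component in T lies in S. *)
have ex : exists j, (der mu j :&: T <= S)%MS.
  exists k; apply/row_subP => i; have := row_sub i (der mu k :&: T)%MS.
  rewrite sub_capmx dk => /andP[/sub_rVP[a ->] aT].
  have [->|a0] := eqVneq a 0; first by rewrite scale0r sub0mx.
  by case/negP: e_notin; rewrite -(scalerK a0 e) scalemx_sub.
case: (ex_minnP ex) => -[|j] jS jmin.
  case/negP: TS; apply: submx_trans jS; rewrite sub_capmx submx_refl andbT.
  exact: submx1.
have /row_subPn[i xS] : ~~ (der mu j :&: T <= S)%MS.
  by apply/negP => /jmin; rewrite ltnn.
move: (row i _) (row_sub i (der mu j :&: T)%MS) xS => x.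
rewrite sub_capmx => /andP[xj xT] xS.
have [s sS' s0] := compl sS x.
have [t [tE tS0]] : exists t, t = x - s /\
    forall y, (y <= S)%MS -> y ** t = 0 by exists (x - s).
have tT : (t <= T)%MS by rewrite tE addmx_sub // eqmx_opp (submx_trans sS').
have tS : ~~ (t <= S)%MS.
  by apply: contra xS => tS; rewrite -(subrK s x) -tE addmx_sub.
have tt : (t ** t <= der mu j.+1)%MS.
  have -> : t ** t = x ** t by rewrite {1}tE amulBl (tS0 s) // subr0.
  exact: der_mul.
have [g gT] := peirce_split (t ** t).
have wS : (t ** t - g *: e <= S)%MS.
  apply: submx_trans jS; rewrite sub_capmx gT andbT addmx_sub // eqmx_opp.
  by rewrite scalemx_sub // e_der.
pose c := sqrtC (- g); have cc : c * c = - g by rewrite -expr2 sqrtCK.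
have [u uE] : exists u, u = t + c *: e by eexists.
have uu : u ** u = t ** t - g *: e.
  have et : e ** t = 0 by apply/peirce0P.
  rewrite uE amulDl !amulDr !(amulZl, amulZr) [t ** e]com et ee !scaler0.
  by rewrite addr0 add0r scalerA cc scaleNr.
have uS y : (y <= S)%MS -> y ** u = 0.
  move=> yS; have /peirce0P ey := submx_trans yS ST.
  by rewrite uE amulDr amulZr tS0 // com ey scaler0 addr0.
have sS'' : subalgebra mu (S + u)%MS.
  move=> y z /sub_addsmxP[[y1 y2] /= ->] /sub_addsmxP[[z1 z2] /= ->].
  rewrite [y2]mx11_scalar [z2]mx11_scalar !mul_scalar_mx amulDl !amulDr.
  rewrite !(amulZl, amulZr) [u ** (_ *m _)]com uu.
  rewrite (uS (y1 *m _)) ?submxMl // (uS (z1 *m _)) ?submxMl //.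
  rewrite !scaler0 addr0 add0r addmx_sub //.
    by apply: submx_trans (addsmxSl _ _); apply: sS; apply: submxMl.
  by apply: submx_trans (addsmxSl _ _); rewrite !scalemx_sub.
(* If e = y + a u with y in S, multiplying by e gives a c = 1; then a t = - y puts t in S. *)
have eS'' : ~~ (e <= S + u)%MS.
  apply/negP => /sub_addsmxP[[y1 y2] /=]; rewrite [y2]mx11_scalar mul_scalar_mx.
  move: (y2 0 0) => a eE; case/negP: tS.
  have yS : (y1 *m S <= S)%MS by apply: submxMl.
  have /peirce0P ey := submx_trans yS ST.
  have et : e ** t = 0 by apply/peirce0P.
  have eE' : e = (a * c) *: e.
    rewrite -[LHS]ee {2}eE amulDr ey add0r amulZr uE amulDr et add0r.
    by rewrite amulZr ee scalerA.
  have ac : a * c = 1.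
    apply/eqP; rewrite -subr_eq0.
    have : (a * c - 1) *: e == 0 by rewrite scalerBl -eE' scale1r subrr.
    by rewrite scaler_eq0 (negbTE e0) orbF.
  have a0 : a != 0 by apply: contra_eq_neq ac => ->; rewrite mul0r eq_sym oner_eq0.
  rewrite -(scalerK a0 t) scalemx_sub //.
  have -> : a *: t = - (y1 *m S).
    apply/eqP; rewrite -addr_eq0 addrC; apply/eqP/(@addIr _ e).
    by rewrite add0r [RHS]eE uE scalerDr scalerA ac scale1r addrA.
  by rewrite eqmx_opp.
exists (S + u)%MS; split=> //; first exact: sub_peirce0.
rewrite (ltn_leqif (mxrank_leqif_sup (addsmxSl _ _))) addsmx_sub negb_and.
rewrite submx_refl /=; apply: contra tS => uSS.
have /peirce0P := submx_trans uSS ST.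
rewrite uE amulDr amulZr ee; have /peirce0P -> := tT; rewrite add0r => ce.
by move: uSS; rewrite uE ce addr0.
Qed.

(** Extend the zero subalgebra inside T repeatedly; the rank grows, so the process ends only at T
    itself. *)
Lemma peirce0_subalgebra : subalgebra mu T.
Proof.
suff H m (S : 'M[C]_n) :
    (n - \rank S <= m)%N -> subalgebra mu S -> (S <= T)%MS -> subalgebra mu T.
  apply: (H n 0); rewrite ?leq_subr ?sub0mx // => x y.
  by rewrite !submx0 => /eqP-> _; rewrite amul0l.
elim: m S => [|m IH] S Sm sS ST; have [TS|TS] := boolP (T <= S)%MS.
- by move=> x y xT yT; apply: submx_trans ST; apply: sS;
     apply: submx_trans TS.
- have [S' [_ _]] := peirce0_extend sS ST TS.
  move: Sm; rewrite leqn0 subn_eq0 => nS rS.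
  by have := leq_trans rS (rank_leq_col S'); rewrite ltnNge nS.
- by move=> x y xT yT; apply: submx_trans ST; apply: sS;
     apply: submx_trans TS.
have [S' [sS' S'T rS]] := peirce0_extend sS ST TS.
apply: IH sS' S'T; rewrite -ltnS; apply: leq_trans Sm.
by rewrite ltn_sub2l // (leq_trans rS) // rank_leq_col.
Qed.
End Peirce.

(** * Structure of the nilpotent part and the classification *)

Section NilpotentPart.
Variables (C : numClosedFieldType) (n : nat) (mu : alg C n).
Hypotheses (com : acomm mu) (compl : ann_compl mu).
Variable (T : 'M[C]_n).
Hypothesis sT : subalgebra mu T.
Local Notation "x ** y" := (amul mu x y) (at level 40, left associativity).
Implicit Types x y z u : 'rV[C]_n.

Local Notation T2 := (prodsp mu T T).

Definition sq_ann y := (y <= T)%MS /\ forall m, (m <= T2)%MS -> m ** y = 0.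

Lemma T2_sub : (T2 <= T)%MS.
Proof. exact/subalgebra_prodsp. Qed.

Lemma T2_subalgebra : subalgebra mu T2.
Proof. by apply/subalgebra_prodsp/prodspS; apply: T2_sub. Qed.

Lemma sq_annD a x y : sq_ann x -> sq_ann y -> sq_ann (x + a *: y).
Proof.
move=> [xT x0] [yT y0]; split=> [|m mT]; first by rewrite addmx_sub ?scalemx_sub.
by rewrite amulDr amulZr x0 // y0 // scaler0 addr0.
Qed.

Lemma sq_ann_split y : (y <= T)%MS ->
  exists2 m, (m <= T2)%MS & sq_ann (y - m).
Proof.
move=> yT; have [m mT m0] := compl T2_subalgebra y; exists m => //.
by split=> //; rewrite addmx_sub // eqmx_opp (submx_trans mT) // T2_sub.
Qed.

Lemma sq_ann_gen u : sq_ann u -> subalgebra mu (u + T2)%MS.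
Proof.
move=> [uT _] x y xu yu; apply: submx_trans (addsmxSr _ _).
have uTT : (u + T2 <= T)%MS by rewrite addsmx_sub uT T2_sub.
by apply: prodsp_mul; apply: submx_trans uTT.
Qed.

(** Apply the annihilating complement to the subalgebra <u> + T^2: [y] may be replaced by an element
    c u + m of it, with m in T^2, and u m = 0. *)
Lemma sq_ann_mul u y : sq_ann u -> sq_ann y -> exists a, u ** y = a *: (u ** u).
Proof.
move=> su sy; have [s /sub_addsmxP[[c d] /= sE] s0] := compl (sq_ann_gen su) y.
exists (c 0 0); have /eqP := s0 u (addsmxSl _ _).
rewrite amulBr subr_eq0 => /eqP->; rewrite sE [c]mx11_scalar mul_scalar_mx.
rewrite amulDr amulZr [u ** (_ *m _)]com (su.2 (d *m _)) ?submxMl // addr0.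
by rewrite mxE eqxx mulr1n.
Qed.

(** Modulo T^2 every row of T has a representative annihilating T^2. If all their squares vanish, so
    do their mutual products, and T^2 <= T^2 T^2. *)
Lemma ex_sq_ann : ~~ (T2 <= prodsp mu T2 T2)%MS ->
  exists2 x, sq_ann x & x ** x != 0.
Proof.
move=> T20.
have ex i : exists x, sq_ann x /\ (row i T - x <= T2)%MS.
  have [m mT sm] := sq_ann_split (row_sub i T).
  by exists (row i T - m); split=> //; rewrite opprB addrC subrK.
have {ex} [x xP] := fin_all_exists ex.
have [/existsP[i xi]|] := boolP [exists i, x i ** x i != 0].
  by exists (x i) => //; case: (xP i).
rewrite negb_exists => /forallP x0; case/negP: T20.
apply/sumsmx_subP => i _; apply/sumsmx_subP => j _; rewrite genmxE.
have [sxi xiT] := xP i; have [sxj xjT] := xP j.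
have xij : x i ** x j = 0.
  have [a ->] := sq_ann_mul sxi sxj.
  by have := x0 i; rewrite negbK => /eqP->; rewrite scaler0.
rewrite -[row i T](subrK (x i)) -[row j T](subrK (x j)).
move: (row i T - x i) (row j T - x j) xiT xjT => p q pT qT.
rewrite amulDl !amulDr xij addr0 (sxj.2 _ pT) [x i ** _]com (sxi.2 _ qT) !addr0.
exact: prodsp_mul.
Qed.

Lemma sq_ann_isotropic u y : sq_ann u -> u ** u = 0 -> sq_ann y -> u ** y = 0.
Proof.
by move=> su uu sy; have [a ->] := sq_ann_mul su sy; rewrite uu scaler0.
Qed.

(** Take z = y - a x orthogonal to x; its square is a multiple of x^2. A square root c then makes z
    + c x isotropic, and isotropic elements are orthogonal to x, so c = 0 and z^2 = 0. *)
Lemma sq_ann_rank1 x y : sq_ann x -> x ** x != 0 -> sq_ann y ->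
  exists a, sq_ann (y - a *: x) /\ (y - a *: x) ** (y - a *: x) = 0.
Proof.
move=> sx xx sy; have [a xy] := sq_ann_mul sx sy; exists a.
have [z zE] : exists z, z = y - a *: x by eexists.
have sz : sq_ann z by rewrite zE -scaleNr; apply: sq_annD.
rewrite -zE; split=> //.
have xz : x ** z = 0 by rewrite zE amulBr amulZr xy subrr.
have zx : z ** x = 0 by rewrite com.
have sxz : sq_ann (x + z) by rewrite -[z]scale1r; apply: sq_annD.
have [b bE] := sq_ann_mul sxz sx.
move: bE; rewrite amulDl zx addr0 !amulDl !amulDr xz zx addr0 add0r => bE.
have b0 : b != 0 by apply: contraNneq xx => b0; rewrite bE b0 scale0r.
have zz : z ** z = (b^-1 - 1) *: (x ** x).
  by rewrite scalerBl scale1r {1}bE scalerK // [x ** x + _]addrC addrK.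
pose c := sqrtC (- (b^-1 - 1)).
have cc : c * c = - (b^-1 - 1) by rewrite -expr2 sqrtCK.
have sw : sq_ann (z + c *: x) by apply: sq_annD.
have ww : (z + c *: x) ** (z + c *: x) = 0.
  rewrite amulDl !amulDr !(amulZl, amulZr) zx xz !scaler0 addr0 add0r.
  by rewrite scalerA cc zz -scalerDl addrN scale0r.
have := sq_ann_isotropic sw ww sx; rewrite amulDl zx add0r amulZl => /eqP.
rewrite scaler_eq0 (negbTE xx) orbF => /eqP c0.
by rewrite zz -[b^-1 - 1]opprK -cc c0 mulr0 oppr0 scale0r.
Qed.

(** N = <x> + T^2 with x^2 != 0. Removing from y in T a part in T^2 and a multiple of x leaves an
    isotropic element annihilating T^2, which therefore annihilates T. *)
Lemma monogenic_split : ~~ (T2 <= prodsp mu T2 T2)%MS ->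
  exists N : 'M[C]_n, [/\ subalgebra mu N, (N <= T)%MS, (1 < \rank N)%N,
    exists2 x : 'rV_n, (x <= N)%MS & (N <= x + prodsp mu N N)%MS &
    forall y, (y <= T)%MS -> exists2 p, (p <= N)%MS &
      forall w, (w <= T)%MS -> (y - p) ** w = 0].
Proof.
move=> T20; have [x sx xx] := ex_sq_ann T20.
have NT : (x + T2 <= T)%MS by rewrite addsmx_sub sx.1 T2_sub.
have ann y : (y <= T)%MS -> exists2 p, (p <= x + T2)%MS &
    forall w, (w <= T)%MS -> (y - p) ** w = 0.
  move=> yT; have [m mT sm] := sq_ann_split yT.
  have [a [sz zz]] := sq_ann_rank1 sx xx sm.
  exists (a *: x + m); first by rewrite addmx_sub_adds ?scalemx_sub.
  move=> w /sq_ann_split[m' m'T sw]; rewrite opprD [- _ - _]addrC addrA.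
  move: (y - m - a *: x) sz zz => z sz zz.
  by rewrite -[w](subrK m') amulDr sq_ann_isotropic // com sz.2 // addr0.
exists (x + T2)%MS; split=> //.
- exact: sq_ann_gen.
- have T2_0 : T2 != 0 by apply: contraNneq T20 => ->; rewrite sub0mx.
  rewrite -mxrank_eq0 -lt0n in T2_0; apply: leq_ltn_trans T2_0 _.
  rewrite (ltn_leqif (mxrank_leqif_sup (addsmxSr _ _))) addsmx_sub negb_and.
  (* x is not in T^2, because T^2 annihilates x and x x != 0. *)
  by apply/orP; left; apply: contraNN xx => /sx.2->.
- exists x; first exact: addsmxSl.
  (* T^2 = N^2, since each element of T differs from one of N by an annihilator of T. *)
  rewrite addsmxS //; apply: prodsp_sub => y z yT zT.
  have [p pN p0] := ann y yT; have [q qN q0] := ann z zT.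
  rewrite -[y](subrK p) amulDl p0 // add0r -[z](subrK q) amulDr com q0 ?add0r.
    exact: prodsp_mul.
  exact: submx_trans NT.
Qed.

(** Take a complement of N in T and correct each basis vector by an element of N. The free parameter
    [q] lets the size of [Z] match the zero summand of [algB]. *)
Lemma ann_basis (N : 'M[C]_n) q : (N <= T)%MS ->
  (forall y, (y <= T)%MS -> exists2 p, (p <= N)%MS &
      forall w, (w <= T)%MS -> (y - p) ** w = 0) ->
  (\rank T - \rank N)%N = q ->
  exists Z : 'M[C]_(q, n), [/\ (Z <= T)%MS, (T <= N + Z)%MS &
    forall (y : 'rV_q) (w : 'rV_n), (w <= T)%MS -> (y *m Z) ** w = 0].
Proof.
move=> NT ann rq.
have rD : \rank (T :\: N)%MS = q.
  by rewrite -rq -(mxrank_cap_compl T N) (capmx_idPr NT) addKn.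
case: _ / rD; have [D [DE TE]] : exists D : 'M_(\rank (T :\: N), n),
    (D <= T)%MS /\ (T <= N + D)%MS.
  exists (row_base (T :\: N)%MS); split.
    by rewrite eq_row_base diffmxSl.
  rewrite addsmxC -(addsmx_diff_cap_eq T N).
  by rewrite addsmxS ?capmxSr // eq_row_base.
have ex i : exists z, [/\ z <= T, row i D - z <= N &
    forall w : 'rV_n, w <= T -> z ** w = 0]%MS.
  have iT : (row i D <= T)%MS by apply: submx_trans (row_sub _ _) DE.
  have [p pN p0] := ann _ iT; exists (row i D - p); split=> //.
    by rewrite addmx_sub // eqmx_opp (submx_trans pN).
  by rewrite opprB addrC subrK.
have {ex} [z zP] := fin_all_exists ex.
have zrow i : row i (\matrix_i z i) = z i by rewrite rowK.
exists (\matrix_i z i); split.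
- by apply/row_subP => i; rewrite zrow; case: (zP i).
- apply: submx_trans TE _; rewrite addsmx_sub addsmxSl; apply/row_subP => i.
  rewrite -(subrK (z i) (row i D)); case: (zP i) => _ zN _.
  by apply: addmx_sub_adds => //; rewrite -zrow row_sub.
- move=> y w wT; rewrite mulmx_sum_row amul_suml big1 // => i _.
  by rewrite amulZl zrow; case: (zP i) => _ _ ->; rewrite ?scaler0.
Qed.
End NilpotentPart.

(** * Assembling the isomorphism *)

Lemma alg_iso_basis (F : fieldType) m n (mu : alg F n) (nu : alg F m)
    (Q : 'M_(m, n)) :
  m = n -> (1%:M <= Q)%MS -> ahom nu mu Q -> alg_iso mu nu.
Proof.
move=> mn; rewrite sub1mx => Qfull Qhom; apply: alg_iso_sym; exists Q; split=> //.
by rewrite /row_free (eqP Qfull) mn.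
Qed.

Lemma basis_of_rank (F : fieldType) n (A : 'M[F]_n) r : \rank A = r ->
  exists P : 'M[F]_(r, n), (P :=: A)%MS.
Proof. by case: _ /; exists (row_base A); apply: eq_row_base. Qed.

(** Nilpotency comes from the trivial intersection of N with D_k; maximality from the single
    generator, which keeps the derived term of index r - 1 nonzero for r = \rank N. *)
Lemma monogenic_max_nil_index (C : numClosedFieldType) n (mu : alg C n) r
    (P : 'M[C]_(r, n)) (N : 'M[C]_n) k :
  acomm mu -> ann_compl mu -> row_free P -> (P :=: N)%MS ->
  (forall i j, i != j -> amul mu (row i P) (row j P) = 0) ->
  subalgebra mu N -> (1 < \rank N)%N -> (der mu k :&: N = 0)%MS ->
  (exists2 x : 'rV_n, (x <= N)%MS & (N <= x + prodsp mu N N)%MS) ->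
  max_nil_index (sub_alg mu P).
Proof.
move=> com compl Pfree PN P0 sN rN kN [x xN Nx].
have Phom : ahom (sub_alg mu P) mu P.
  by apply: sub_alg_hom => y z; rewrite !PN; apply: sN.
have rE : \rank N = r by rewrite -PN (eqP Pfree).
have ncom := acomm_sub Pfree Phom com.
have ncompl := ann_compl_sub Pfree Phom compl.
have ev : evolution (sub_alg mu P).
  exists 1%:M; split=> [|i j ij]; first exact: unitmx1.
  by rewrite !rowE !mulmx1 amul_delta /sub_alg P0 ?mul0mx.
have nil : nilpotent (sub_alg mu P).
  apply: (@der_eq0_nilpotent _ _ _ ncom ncompl k).
  apply/eqP; rewrite -(mulmx_free_eq0 _ Pfree) -submx0 -kN sub_capmx.
  by rewrite (der_sub_alg Phom) -PN submxMl.
have gen : exists t : 'rV_r, (1%:M <= t + der (sub_alg mu P) 1)%MS.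
  have /submxP[t tE] : (x <= P)%MS by rewrite PN.
  exists t; rewrite -(submxMfree _ _ Pfree) mul1mx addsmxMr -tE PN.
  apply: submx_trans Nx _; rewrite addsmxS //.
  apply: prodsp_sub => y z; rewrite -!PN => /submxP[a ->] /submxP[b ->].
  by rewrite -Phom submxMr // prodsp_mul ?submx1.
case: r P {kN Phom} Pfree PN P0 rE ncom ncompl ev nil gen =>
  [|r] P Pfree PN P0 rE ncom ncompl ev nil gen; rewrite rE // in rN.
apply: max_nil_index_der => //; rewrite -mxrank_eq0 -lt0n.
by apply: leq_trans (der_rank ncom ncompl r gen); rewrite subSn ?subnn.
Qed.

Lemma complete_classification (C : numClosedFieldType) n (mu : alg C n) :
  evolution mu -> complete mu -> ~ nilpotent mu ->
  alg_iso mu (algA C n)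
   \/ exists (s : nat) (Et : alg C s),
        [/\ (2 <= s)%N, (s < n)%N, max_nil_index Et & alg_iso mu (algB n Et)].
Proof.
move=> ev cmu nnil; have com := evolution_acomm ev.
have compl := complete_ann_compl cmu.
have [k [e [e0 ee dk]]] := ex_idempotent_ideal ev cmu nnil.
pose T := peirce0 mu e.
have sT : subalgebra mu T := peirce0_subalgebra com compl e0 ee dk.
have eT : ~~ (e <= T)%MS := e_notin e0 ee.
have eTE : (1%:M <= e + T)%MS := peirce_sum compl ee dk.
have eT0 x : (x <= T)%MS -> amul mu e x = 0 by move/peirce0P.
have Te0 x : (x <= T)%MS -> amul mu x e = 0 by rewrite com; apply: eT0.
have rT : \rank T = (n - 1)%N.
  have Tn : (\rank T < n)%N.
    rewrite ltnNge; apply: contra eT => nT; apply: submx_full.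
    by rewrite /row_full eqn_leq rank_leq_col.
  have := leq_trans (mxrankS eTE) (mxrank_adds_leqif _ _).
  rewrite mxrank1 rank_rV e0 => nT; apply/eqP; rewrite eqn_leq.
  by rewrite leq_subLR nT andbT -ltnS subn1 prednK // (leq_ltn_trans _ Tn).
have n0 : (0 < n)%N.
  case: (n) e e0 {ee dk T sT eT eTE eT0 Te0 rT} => // e.
  by rewrite thinmx0 eqxx.
have ehom : ahom (idem1 C) mu e.
  move=> x y; rewrite amul_idem1 mul_scalar_mx.
  rewrite [x]mx11_scalar [y]mx11_scalar !mul_scalar_mx amulZl amulZr ee.
  by rewrite scalerA !mxE eqxx !mulr1n.
have kT : (der mu k :&: T = 0)%MS.
  apply/eqP; rewrite -submx0; apply/row_subP => i.
  have := row_sub i (der mu k :&: T)%MS.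
  rewrite sub_capmx dk => /andP[/sub_rVP[a ->] aT].
  have [->|a0] := eqVneq a 0; first by rewrite scale0r sub0mx.
  by case/negP: eT; rewrite -(scalerK a0 e) scalemx_sub.
have [TT|TT] :=
  boolP (prodsp mu T T <= prodsp mu (prodsp mu T T) (prodsp mu T T))%MS.
  (* If T^2 = T^2 T^2, then T^2 lies in every D_j, hence in the intersection of D_k and T, which is
     zero. *)
  left; have T2der j : (prodsp mu T T <= der mu j)%MS.
    by elim: j => [|j IH]; [apply: submx1 | apply/(submx_trans TT)/prodspS].
  have T20 : prodsp mu T T = 0.
    apply/eqP; rewrite -submx0 -kT sub_capmx T2der.
    exact/subalgebra_prodsp.
  have [P PT] := basis_of_rank rT.
  apply: (@alg_iso_basis _ _ _ _ _ (col_mx e P)); first by rewrite subnKC.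
    by rewrite -addsmxE (submx_trans eTE) // addsmxS // PT.
  have PsT (x : 'rV_(n - 1)) : (x *m P <= T)%MS by rewrite -PT submxMl.
  apply: dsum_hom => // [x y|x y|x y].
  - rewrite amul_zero_alg mul0mx; apply/esym/eqP; rewrite -submx0 -T20.
    exact: prodsp_mul.
  - by rewrite [x]mx11_scalar mul_scalar_mx amulZl eT0 ?scaler0.
  - by rewrite [x]mx11_scalar mul_scalar_mx amulZr Te0 ?scaler0.
(* [N] supplies the summand of maximal index, and a complement [Z] of it in T that annihilates T
   supplies the zero summand. *)
right; have [N [sN NT rN genN annN]] := monogenic_split com compl sT TT.
have [r [P [Pfree PN P0]]] := complete_natural_basis cmu sN.
have rE : \rank N = r by rewrite -PN (eqP Pfree).
have rn : (r < n)%N.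
  by rewrite -rE; apply: leq_ltn_trans (mxrankS NT) _; rewrite rT subn1 prednK.
have [|Z [ZT TZ Z0]] := ann_basis (q := (n - r - 1)%N) NT annN.
  by rewrite rT rE subnAC.
exists r, (sub_alg mu P); split=> //; first by rewrite -rE.
  apply: (@monogenic_max_nil_index _ _ _ _ P N k) => //.
  by apply/eqP; rewrite -submx0 -kT capmxS.
apply: (@alg_iso_basis _ _ _ _ _ (col_mx e (col_mx P Z))).
- by rewrite addnA add1n subnAC -subnDA add1n addnC subnK.
- rewrite -addsmxE (submx_trans eTE) // addsmxS // -addsmxE.
  by apply: submx_trans TZ _; rewrite addsmxS // PN.
have PsT (x : 'rV_r) : (x *m P <= T)%MS.
  by apply: submx_trans NT; rewrite -PN submxMl.
have ZsT (x : 'rV_(n - r - 1)) : (x *m Z <= T)%MS.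
  exact: submx_trans (submxMl _ _) ZT.
have PZsT (x : 'rV_(r + (n - r - 1))) : (x *m col_mx P Z <= T)%MS.
  by rewrite -[x]hsubmxK mul_row_col addmx_sub.
apply: dsum_hom => // [|x y|x y].
- apply: dsum_hom => [|x y|x y|x y].
  + by apply: sub_alg_hom => x y; rewrite !PN; apply: sN.
  + by rewrite amul_zero_alg mul0mx Z0.
  + by rewrite com Z0.
  + by rewrite Z0.
- by rewrite [x]mx11_scalar mul_scalar_mx amulZl eT0 ?scaler0.
- by rewrite [x]mx11_scalar mul_scalar_mx amulZr Te0 ?scaler0.
Qed.

Theorem theorem3p3 (R : realType) (n : nat) (E : alg R[i] n) :
  evolution E -> complete E -> ~ nilpotent E ->
  (alg_iso E (algA R[i] n)
   \/ exists (s : nat) (Et : alg R[i] s),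
        [/\ (2 <= s)%N, (s < n)%N, max_nil_index Et & alg_iso E (algB n Et)])
  /\
  (* the listed algebras are pairwise non-isomorphic *)
  (forall (s : nat) (Et : alg R[i] s), (2 <= s)%N -> (s < n)%N -> max_nil_index Et ->
     ~ alg_iso (algA R[i] n) (algB n Et))
  /\
  (forall (s s' : nat) (Et : alg R[i] s) (Et' : alg R[i] s'),
     (2 <= s)%N -> (s < n)%N -> max_nil_index Et ->
     (2 <= s')%N -> (s' < n)%N -> max_nil_index Et' ->
     alg_iso (algB n Et) (algB n Et') -> alg_iso Et Et').
Proof.
move=> ev cmu nnil; split; first exact: complete_classification.
split=> [s Et s2 _ Em|s s' Et Et' s2 _ Em s2' _ Em'].
  exact: algA_not_algB.
exact: algB_inj.
Qed.
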